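(* In the setting described in the context, let $\mathcal{P}$ be a bounded polyhedral packing. The set of $\mathbf{s}\in V^*$ at which $Z(\mathbf{s})=\sum_{\mathbf{b}\in\mathcal{P}}e^{-\mathbf{b}\cdot\mathbf{s}}$ converges absolutely is $$A=\bigcup_{w\in W}w^TA_0,\qquad A_0=\{\mathbf{s}\in V^*:\ \boldsymbol{\alpha}_j\cdot\mathbf{s}\ge0\text{ for all }j,\ \text{and }\boldsymbol{\alpha}_j\cdot\mathbf{s}=0\text{ for at most one }j\}.$$
   Context: Let $\Pi$ be a convex polyhedron with vertices $1,\ldots,m$ and faces $1,\ldots,n$. Augmented curvature-center coordinates: an oriented generalized circle is represented by $\mathbf{c}=(\tilde b,b,h_1,h_2)^T\in\mathbb{R}^4$ ($b$ signed curvature, $\tilde b$ curvature after inversion in the unit circle, $(h_1,h_2)$ equal to $b$ times the center; for a line $b=0$ and $(h_1,h_2)$ is the unit normal; orientation inward if $b>0$, outward if $b<0$). Let $P=\begin{pmatrix}0&-\tfrac12&0&0\\-\tfrac12&0&0&0\\0&0&1&0\\0&0&0&1\end{pmatrix}$. A polyhedral configuration for $\Pi$: oriented circles $c_1,\ldots,c_m$ with pairwise disjoint interiors, $c_i,c_k$ tangent iff vertices $i,k$ adjacent (else disjoint); oriented dual circles $d_1,\ldots,d_n$ with pairwise disjoint interiors, tangent iff the faces share an edge (else disjoint); $c_i\perp d_j$ if vertex $i$ is on face $j$, else disjoint. $W_{\mathrm{geom}}$ is generated by inversions in the $d_j$; the packing $\mathcal{P}$ is the family of tuples $(gc_1,\ldots,gc_m)$,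 $g\in W_{\mathrm{geom}}$; bounded means all circles lie in a bounded region of $\mathbb{C}$. $Z$ is summed over all Descartes tuples $\mathbf{b}\in\mathbb{R}^m$ (curvature vectors of these tuples) with multiplicity (once per $g$); since the imaginary part of $\mathbf{s}$ does not affect absolute convergence, $\mathbf{s}$ is taken real. Let $C$ be the $4\times m$ matrix with columns $\mathbf{c}_i$; $V$ = column space of $C^T$ (contains all Descartes tuples); $V^*=\mathbb{R}^m/\ker C$, with the pairing $\mathbf{b}\cdot\mathbf{s}$ ($\mathbf{b}\in V$, $\mathbf{s}\in V^*$) well defined, so $Z$ is a function on $V^*$. Simple roots $\boldsymbol{\alpha}_j=-C^TP\mathbf{d}_j\in V$. Take $\tilde C$ ($m\times4$) with $C\tilde C=I_4$, $\tilde G=\tilde CP^{-1}\tilde C^T$, $\sigma_j(\mathbf{b})=\mathbf{b}-2(\boldsymbol{\alpha}_j^T\tilde G\mathbf{b})\boldsymbol{\alpha}_j$ on $V$ (independent of $\tilde C$), $W$ the group generated by $\sigma_1,\ldots,\sigma_n$, and for $w\in W$ let $w^T:V^*\to V^*$ be the dual map, $(w\mathbf{b})\cdot\mathbf{s}=\mathbf{b}\cdot(w^T\mathbf{s})$. *)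

(* Defs.v *)
From HB Require Import structures.
From mathcomp Require Import all_boot all_order all_algebra.
From mathcomp Require Import complex.
From mathcomp Require Import all_classical all_reals all_analysis.

Set Implicit Arguments.
Unset Strict Implicit.
Unset Printing Implicit Defensive.

Import Order.TTheory GRing.Theory Num.Theory.

Local Open Scope classical_set_scope.
Local Open Scope ring_scope.
Local Open Scope complex_scope.
Local Open Scope quotient_scope.

(** * Convex polyhedra *)

Section Polyhedron.
Variables (R : realType) (m n : nat).
Variable v : 'I_m -> 'rV[R]_3.

(* A face of the polytope conv {v_0, ..., v_(m-1)} is the set where a linear
   functional attains its maximum; it is recorded by the set of indices of the
   vertices it contains. *)
Definition is_face (S : {set 'I_m}) : Prop :=
  exists (a : 'cV[R]_3) (beta : R), forall i : 'I_m,
    (v i *m a) 0 0 <= beta /\ ((v i *m a) 0 0 = beta <-> i \in S).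

(* The rank of the homogenized points (1, v_i), i \in S, which is one more than
   the dimension of the affine hull of the v_i, i \in S. *)
Definition aff_rank (S : {set 'I_m}) : nat :=
  \rank (\sum_(i in S) <<row_mx (1%:M : 'M[R]_1) (v i)>>)%MS.

Definition is_facet (S : {set 'I_m}) : Prop := is_face S /\ aff_rank S = 3%N.

(* Here "face of Pi" in the sense of three-dimensional polyhedra means facet. *)
Record convex_polyhedron (F : 'I_n -> {set 'I_m}) : Prop := ConvexPolyhedron {
  polyhedron_dim : aff_rank [set: 'I_m]%SET = 4%N;
  polyhedron_vertex : forall i, is_face [set i]%SET;
  polyhedron_face_inj : injective F;
  polyhedron_faceP : forall S, is_facet S <-> exists j, S = F j
}.

Definition adjacent_vertices (i k : 'I_m) : Prop :=
  i <> k /\ is_face [set i; k]%SET.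

Definition share_edge (F : 'I_n -> {set 'I_m}) (j l : 'I_n) : Prop :=
  j <> l /\ exists i k, [/\ adjacent_vertices i k,
    i \in F j, k \in F j, i \in F l & k \in F l].

End Polyhedron.

(** * Oriented generalized circles *)

Section Circles.
Variable R : realType.

(* The Riemann sphere, [None] being the point at infinity. *)
Definition Chat : Type := option R[i].

Definition dotC (z w : R[i]) : R :=
  complex.Re z * complex.Re w + complex.Im z * complex.Im w.

Implicit Types c d : 'cV[R]_4.

Definition cocurv c : R := c 0 0.
Definition curv c : R := c 1 0.
Definition cnorm c : R[i] := c (inord 2) 0 +i* c (inord 3) 0.
Definition center c : R[i] := cnorm c / (curv c)%:C.

(* If b <> 0, the image under inversion in the unit circle of the circle with
   center a and signed curvature b has signed curvature b (|a|^2 - 1/b^2), which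
   is (|h|^2 - 1) / b for h = b a.  If b = 0, the condition is that h is a unit
   vector. *)
Definition is_ocircle c : Prop :=
  cocurv c * curv c = dotC (cnorm c) (cnorm c) - 1.

(* For b = 0 the line is h . z = t with t = cocurv c / 2: inversion in the unit
   circle sends the half-plane h . z > t, for t > 0, to the disc with diameter
   [0, h / t], of curvature 2 t. *)
Definition circle c : set Chat := [set p |
  if curv c == 0 then
    if p is Some z then dotC (cnorm c) z = cocurv c / 2 else True
  else if p is Some z return Prop then
    `|z - center c| = (`|(curv c)^-1|)%:C else False].

Definition circle_interior c : set Chat := [set p |
  if 0 < curv c then
    if p is Some z then `|z - center c| < ((curv c)^-1)%:C else false
  else if curv c < 0 then
    if p is Some z then (`|(curv c)^-1|)%:C < `|z - center c| else true
  else
    if p is Some z then cocurv c / 2 < dotC (cnorm c) z else false].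

Definition disjoint_circles c d : Prop := circle c `&` circle d = set0.

Definition disjoint_interiors c d : Prop :=
  circle_interior c `&` circle_interior d = set0.

Definition tangent c d : Prop := exists p, circle c `&` circle d = [set p].

(* A nonzero normal vector at a point z of the circle: b (z - center) if b <> 0,
   and the opposite of the unit normal if b = 0. *)
Definition normal_at c (z : R[i]) : R[i] := (curv c)%:C * z - cnorm c.

(* Two distinct generalized circles that cross do so at some finite point. *)
Definition orthogonal_circles c d : Prop :=
  (exists z : R[i], circle c (Some z) /\ circle d (Some z)) /\
  (forall z : R[i], circle c (Some z) -> circle d (Some z) ->
     dotC (normal_at c z) (normal_at d z) = 0).

Definition inversion d (p : Chat) : Chat :=
  if curv d == 0 then
    if p is Some z then
      Some (z - (2 * (dotC (cnorm d) z - cocurv d / 2))%:C * cnorm d)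
    else None
  else
    if p is Some z then
      if z == center d then None
      else Some (center d + ((curv d)^-1 ^+ 2)%:C / (z - center d)^*)
    else Some (center d).

(* The image of an oriented circle under a transformation g of the Riemann
   sphere is the oriented circle whose interior is the image of the interior.
   It exists and is unique when g is a product of inversions. *)
Definition circle_image (g : Chat -> Chat) c : 'cV[R]_4 :=
  xget c [set c' |
    is_ocircle c' /\ circle_interior c' = g @` circle_interior c].

End Circles.

(** * Generated groups of transformations *)

Inductive generated_group (T I : Type) (f : I -> T -> T) : set (T -> T) :=
| gen_id : generated_group f id
| gen_gen i : generated_group f (f i)
| gen_comp u w :
    generated_group f u -> generated_group f w -> generated_group f (u \o w)
| gen_inv u w :
    generated_group f u -> cancel u w -> cancel w u -> generated_group f w.

(** * Polyhedral packings *)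

Section Packing.
Variables (R : realType) (m n : nat).

Record polyhedral_configuration (v : 'I_m -> 'rV[R]_3)
    (F : 'I_n -> {set 'I_m}) (c : 'I_m -> 'cV[R]_4) (d : 'I_n -> 'cV[R]_4) :
    Prop := PolyhedralConfiguration {
  config_circle : forall i, is_ocircle (c i);
  config_dual_circle : forall j, is_ocircle (d j);
  config_interiors : forall i k, i <> k -> disjoint_interiors (c i) (c k);
  config_tangent : forall i k, adjacent_vertices v i k -> tangent (c i) (c k);
  config_disjoint : forall i k, i <> k -> ~ adjacent_vertices v i k ->
    disjoint_circles (c i) (c k);
  config_dual_interiors :
    forall j l, j <> l -> disjoint_interiors (d j) (d l);
  config_dual_tangent : forall j l, share_edge v F j l -> tangent (d j) (d l);
  config_dual_disjoint : forall j l, j <> l -> ~ share_edge v F j l ->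
    disjoint_circles (d j) (d l);
  config_orthogonal : forall i j, i \in F j -> orthogonal_circles (c i) (d j);
  config_cross_disjoint : forall i j, i \notin F j ->
    disjoint_circles (c i) (d j)
}.

Variables (c : 'I_m -> 'cV[R]_4) (d : 'I_n -> 'cV[R]_4).

Definition Wgeom : set (Chat R -> Chat R) :=
  generated_group (fun j => inversion (d j)).

(* The packing is the family of tuples (g c_0, ..., g c_(m-1)), indexed by the
   elements g of Wgeom. *)
Definition packing_tuple (g : Chat R -> Chat R) (i : 'I_m) : 'cV[R]_4 :=
  circle_image g (c i).

Definition descartes_tuple (g : Chat R -> Chat R) : 'cV[R]_m :=
  \col_i curv (packing_tuple g i).

Definition bounded_packing : Prop :=
  exists M : R, forall g i p, Wgeom g -> circle (packing_tuple g i) p ->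
    exists2 z : R[i], p = Some z & `|z| <= M%:C.

End Packing.

(** * The space V and its dual *)

Section Dual.
Variables (R : realType) (m : nat).

Definition dotv (b s : 'cV[R]_m) : R := (b^T *m s) 0 0.

Definition circle_mx (c : 'I_m -> 'cV[R]_4) : 'M[R]_(4, m) :=
  \matrix_(k, i) c i k 0.

Variable C : 'M[R]_(4, m).

Definition Vspace : set 'cV[R]_m := range (fun x : 'cV[R]_4 => C^T *m x).

Definition ker_eq (s t : 'cV[R]_m) : bool := C *m (s - t) == 0.

Lemma ker_eq_refl : reflexive ker_eq.
Proof. by move=> s; rewrite /ker_eq subrr mulmx0. Qed.

Lemma ker_eq_sym : symmetric ker_eq.
Proof. by move=> s t; rewrite /ker_eq -opprB mulmxN oppr_eq0. Qed.

Lemma ker_eq_trans : transitive ker_eq.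
Proof.
move=> t s u /eqP st /eqP tu; apply/eqP.
by rewrite -[s](subrK t) -addrA mulmxDr st tu addr0.
Qed.

Canonical ker_equiv := EquivRel ker_eq ker_eq_refl ker_eq_sym ker_eq_trans.

(* V^* = R^m / ker C *)
Definition Vdual : Type := {eq_quot ker_equiv}.

Definition pairing (b : 'cV[R]_m) (s : Vdual) : R := dotv b (repr s).

Lemma pairing_pi (b s : 'cV[R]_m) :
  Vspace b -> pairing b (\pi_Vdual s) = dotv b s.
Proof.
case=> x _ <-; rewrite /pairing /dotv.
have /eqmodP : repr (\pi_Vdual s) = s %[mod_eq ker_equiv] by rewrite reprK.
rewrite /= /ker_eq mulmxBr subr_eq0 => /eqP e.
by rewrite trmx_mul trmxK -!mulmxA e.
Qed.

(* The map w^T on V^* dual to the restriction of w to V; the elements of V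
   separate the points of V^*, hence w^T s is unique. *)
Definition dual_map (w : 'cV[R]_m -> 'cV[R]_m) (s : Vdual) : Vdual :=
  xget s [set t | forall b, Vspace b -> pairing (w b) s = pairing b t].

End Dual.

(** * Simple roots and the group W *)

Section Roots.
Variable R : realType.

Definition Pmx : 'M[R]_4 := \matrix_(i, j) (nth [::] [::
  [::      0; - 2^-1; 0; 0];
  [:: - 2^-1;      0; 0; 0];
  [::      0;      0; 1; 0];
  [::      0;      0; 0; 1]] i)`_j.

Variables (m n : nat) (c : 'I_m -> 'cV[R]_4) (d : 'I_n -> 'cV[R]_4).

Definition alpha (j : 'I_n) : 'cV[R]_m := - ((circle_mx c)^T *m Pmx *m d j).

Definition Gtilde (Ct : 'M[R]_(m, 4)) : 'M[R]_m := Ct *m invmx Pmx *m Ct^T.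

(* [sigma] and [Wgroup] act on all of R^m; only their action on V, which does
   not depend on the right inverse [Ct] of the circle matrix, is ever used. *)
Definition sigma (Ct : 'M[R]_(m, 4)) (j : 'I_n) (b : 'cV[R]_m) : 'cV[R]_m :=
  b - (2 * dotv (alpha j) (Gtilde Ct *m b)) *: alpha j.

Definition Wgroup (Ct : 'M[R]_(m, 4)) : set ('cV[R]_m -> 'cV[R]_m) :=
  generated_group (sigma Ct).

Definition A0 : set (Vdual (circle_mx c)) := [set s |
  (forall j, 0 <= pairing (alpha j) s) /\
  (forall j l, pairing (alpha j) s = 0 -> pairing (alpha l) s = 0 -> j = l)].

(* Absolute convergence of the sum over the packing of exp (- b . s); each g in
   [Wgeom] contributes one term. *)
Definition Z_converges (s : Vdual (circle_mx c)) : Prop :=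
  summable (Wgeom d)
    (fun g => (expR (- pairing (descartes_tuple c g) s))%:E).

End Roots.

Arguments A0 {R m n} c d.
Arguments Z_converges {R m n} c d s.

(* Main.v *)
(* A generalized circle is a spacelike unit vector of the form <,> with matrix P,
   a point of the Riemann sphere is a ray of null vectors, and inversion in d is
   the reflection in d.  Through s |-> C s, the space V^* becomes R^4, the pairing
   of the Descartes tuple of g with s becomes the curvature of g (C s), A_0 becomes
   the cone <d_j, y> <= 0 (with at most one equality), and W acts by the reflections
   in the d_j.  Disjointness of the dual interiors gives <d_j, d_l> <= -1 for j <> l.

   Boundedness of the packing puts infinity in a translate of the fundamental
   chamber, away from the points of tangency of its walls.  Seen from there, the
   curvatures of the dual circles grow at least linearly along reduced words, so
   for y in A_0 the curvature of w y grows at least quadratically in the length of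
   w, which beats the exponential number of words.  Conversely, if the sum
   converges then the curvature attains its minimum on the orbit of y; a minimizer
   lies in the closed chamber, and on at most one wall, since two walls would give
   it an infinite dihedral stabilizer. *)
From mathcomp Require Import all_boot all_order all_algebra.
From mathcomp Require Import complex ring lra finmap.
From mathcomp Require Import all_classical all_reals all_analysis.
Require Import Defs.

Set Implicit Arguments.
Unset Strict Implicit.
Unset Printing Implicit Defensive.

Import Order.TTheory GRing.Theory Num.Theory.

Local Open Scope classical_set_scope.
Local Open Scope ring_scope.
Local Open Scope complex_scope.

(** * The Lorentz form on R^4 and its reflections *)

Section Lorentz.
Variable R : realType.
Implicit Types (x y u v c d : 'cV[R]_4) (a b k : R).

Definition h1 x : R := x (inord 2) 0.
Definition h2 x : R := x (inord 3) 0.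

Definition vec4 (a b k l : R) : 'cV[R]_4 := \col_i [:: a; b; k; l]`_i.

Definition ip x y : R :=
  h1 x * h1 y + h2 x * h2 y - (cocurv x * curv y + curv x * cocurv y) / 2.

Definition refl d x : 'cV[R]_4 := x - (2 * ip d x) *: d.

(** The closed future light cone of the form, whose signature is (3,1); nonnegative [cocurv] and
    [curv] select one of the two halves. *)
Definition future u : Prop := [/\ 0 <= cocurv u, 0 <= curv u & ip u u <= 0].

Lemma sum4 (V : zmodType) (F : 'I_4 -> V) :
  \sum_i F i = F 0 + F 1 + F (inord 2) + F (inord 3).
Proof.
rewrite !big_ord_recl big_ord0 addr0 !addrA.
by congr (_ + F _ + F _ + F _); apply: val_inj; rewrite //= inordK.
Qed.

Lemma vec4P x y : cocurv x = cocurv y -> curv x = curv y ->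
  h1 x = h1 y -> h2 x = h2 y -> x = y.
Proof.
move=> e0 e1 e2 e3; apply/matrixP => i j; rewrite (ord1 j) {j}.
case: i => -[|[|[|[|//]]]] /= p.
- by rewrite (_ : Ordinal p = 0) //; apply: val_inj.
- by rewrite (_ : Ordinal p = 1) //; apply: val_inj.
- by rewrite (_ : Ordinal p = inord 2) //; apply: val_inj; rewrite /= inordK.
- by rewrite (_ : Ordinal p = inord 3) //; apply: val_inj; rewrite /= inordK.
Qed.

Lemma vec4E a b k l : (cocurv (vec4 a b k l) = a) * (curv (vec4 a b k l) = b) *
  (h1 (vec4 a b k l) = k) * (h2 (vec4 a b k l) = l).
Proof. by rewrite /cocurv /curv /h1 /h2 /vec4 !mxE /= !inordK. Qed.

Lemma coordD x y : (cocurv (x + y) = cocurv x + cocurv y) *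
  (curv (x + y) = curv x + curv y) * (h1 (x + y) = h1 x + h1 y) *
  (h2 (x + y) = h2 x + h2 y).
Proof. by rewrite /cocurv /curv /h1 /h2 !mxE. Qed.

Lemma coordN x : (cocurv (- x) = - cocurv x) * (curv (- x) = - curv x) *
  (h1 (- x) = - h1 x) * (h2 (- x) = - h2 x).
Proof. by rewrite /cocurv /curv /h1 /h2 !mxE. Qed.

Lemma coordZ a x : (cocurv (a *: x) = a * cocurv x) *
  (curv (a *: x) = a * curv x) * (h1 (a *: x) = a * h1 x) *
  (h2 (a *: x) = a * h2 x).
Proof. by rewrite /cocurv /curv /h1 /h2 !mxE. Qed.

Definition coordE := (vec4E, coordD, coordN, coordZ).

Lemma ipC x y : ip x y = ip y x.
Proof. by rewrite /ip; ring. Qed.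

Lemma ipDr x y z : ip x (y + z) = ip x y + ip x z.
Proof. by rewrite /ip !coordE; ring. Qed.

Lemma ipNr x y : ip x (- y) = - ip x y.
Proof. by rewrite /ip !coordE; ring. Qed.

Lemma ipZr a x y : ip x (a *: y) = a * ip x y.
Proof. by rewrite /ip !coordE; ring. Qed.

Lemma ipDl x y z : ip (y + z) x = ip y x + ip z x.
Proof. by rewrite ipC ipDr !(ipC x). Qed.

Lemma ipNl x y : ip (- y) x = - ip y x.
Proof. by rewrite ipC ipNr (ipC x). Qed.

Lemma ipZl a x y : ip (a *: y) x = a * ip y x.
Proof. by rewrite ipC ipZr (ipC x). Qed.

Lemma ip0r x : ip x 0 = 0.
Proof. by rewrite -(scale0r 0) ipZr mul0r. Qed.

Definition ipE := (ipDr, ipDl, ipNr, ipNl, ipZr, ipZl).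

Lemma ocircle_ip c : is_ocircle c <-> ip c c = 1.
Proof. by rewrite /is_ocircle /dotC /ip /=; split=> h; rewrite /h1 /h2 in h *; lra. Qed.

Lemma refl_is_linear d : linear (refl d).
Proof.
move=> a x y; rewrite /refl !ipE scalerBr scalerA addrACA -opprD -scalerDl.
by congr (_ - _ *: _); ring.
Qed.

Lemma reflK d x : ip d d = 1 -> refl d (refl d x) = x.
Proof.
move=> e; rewrite /refl !ipE e -addrA -opprD -scalerDl.
by rewrite [X in X *: d](_ : _ = 0) ?scale0r ?subr0 //; ring.
Qed.

Lemma refl_id d : ip d d = 1 -> refl d d = - d.
Proof. by move=> e; rewrite /refl e mulr1 scaler_nat mulr2n opprD addrA subrr sub0r. Qed.

Lemma ip_refl d x y : ip d d = 1 -> ip (refl d x) (refl d y) = ip x y.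
Proof. by move=> e; rewrite /refl !ipE e (ipC x d); ring. Qed.

(** Cauchy-Schwarz bounds the planar part by the product of the two cone inequalities, and the
    inequality of arithmetic and geometric means bounds that product by the remaining terms. *)
Lemma future_ip_le0 u v : future u -> future v -> ip u v <= 0.
Proof.
case=> u0 u1 uu [v0 v1 vv]; rewrite /ip in uu vv *.
set a := cocurv u in u0 uu *; set b := curv u in u1 uu *.
set a' := cocurv v in v0 vv *; set b' := curv v in v1 vv *.
set k := h1 u in uu *; set l := h2 u in uu *.
set k' := h1 v in vv *; set l' := h2 v in vv *.
have {}uu : k ^+ 2 + l ^+ 2 <= a * b by lra.
have {}vv : k' ^+ 2 + l' ^+ 2 <= a' * b' by lra.
suff : k * k' + l * l' <= (a * b' + b * a') / 2 by lra.
have h : (k * k' + l * l') ^+ 2 <= ((a * b' + b * a') / 2) ^+ 2.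
  apply: (@le_trans _ _ ((k ^+ 2 + l ^+ 2) * (k' ^+ 2 + l' ^+ 2))).
    rewrite -subr_ge0 (_ : _ - _ = (k * l' - l * k') ^+ 2); last by ring.
    exact: sqr_ge0.
  apply: (@le_trans _ _ ((a * b) * (a' * b'))).
    by apply: ler_pM => //; rewrite addr_ge0 ?sqr_ge0.
  rewrite -subr_ge0 (_ : _ - _ = ((a * b' - b * a') / 2) ^+ 2); last by field.
  exact: sqr_ge0.
apply: le_trans (ler_norm _) _.
rewrite -(@ler_pXn2r _ 2) ?nnegrE ?divr_ge0 ?addr_ge0 ?mulr_ge0 //.
by rewrite real_normK ?num_real.
Qed.

(** The coordinates [cocurv] and [curv] are -2 times the pairings with the null vectors (0,1,0,0)
    and (1,0,0,0). The vectors written out in the proof are the images of these two under the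
    reflection, so both signs follow from [future_ip_le0]. *)
Lemma future_refl d u : ip d d = 1 -> future u -> future (refl d u).
Proof.
move=> e fu; have [u0 u1 uu] := fu; split; last by rewrite ip_refl.
- have : future (vec4 (cocurv d ^+ 2) (h1 d ^+ 2 + h2 d ^+ 2)
    (cocurv d * h1 d) (cocurv d * h2 d)).
    rewrite /future /ip !coordE; split; rewrite ?addr_ge0 ?sqr_ge0 //.
    by rewrite le_eqVlt; apply/orP; left; apply/eqP; field.
  move/(future_ip_le0 fu); rewrite /refl /ip in e *; rewrite !coordE => h.
  have {}e : h1 d ^+ 2 + h2 d ^+ 2 = 1 + cocurv d * curv d by lra.
  rewrite e in h; nra.
- have : future (vec4 (h1 d ^+ 2 + h2 d ^+ 2) (curv d ^+ 2)
    (curv d * h1 d) (curv d * h2 d)).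
    rewrite /future /ip !coordE; split; rewrite ?addr_ge0 ?sqr_ge0 //.
    by rewrite le_eqVlt; apply/orP; left; apply/eqP; field.
  move/(future_ip_le0 fu); rewrite /refl /ip in e *; rewrite !coordE => h.
  have {}e : h1 d ^+ 2 + h2 d ^+ 2 = 1 + cocurv d * curv d by lra.
  rewrite e in h; nra.
Qed.

(** The cone contains no line: both null coordinates vanish, and on the remaining plane the form is
    positive definite. *)
Lemma future_anti u : future u -> future (- u) -> u = 0.
Proof.
rewrite /future !coordE => -[a b k] [a' b' _].
have e0 : cocurv u = 0 by lra.
have e1 : curv u = 0 by lra.
rewrite /ip e0 e1 in k.
have z0 : forall v, v = 0 :> 'cV[R]_4 <->
    [/\ cocurv v = 0, curv v = 0, h1 v = 0 & h2 v = 0].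
  move=> v; split=> [->|[]]; first by rewrite /cocurv /curv /h1 /h2 !mxE.
  by move=> ? ? ? ?; apply: vec4P; rewrite /cocurv /curv /h1 /h2 [RHS]mxE.
by apply/z0; split => //; nra.
Qed.

Lemma future_neq0 u : future u -> u <> 0 -> 0 < cocurv u + curv u.
Proof.
move=> fu un; rewrite lt_neqAle addr_ge0 ?andbT; [|by case: fu..].
apply/eqP => e; apply: un; apply: future_anti => //.
have [u0 u1 uu] := fu; rewrite /future !coordE ipNl ipNr opprK; split=> //; lra.
Qed.

End Lorentz.

(** * Points of the Riemann sphere as null vectors *)

Section Sphere.
Variable R : realType.
Implicit Types (x y u v c d : 'cV[R]_4) (a b k : R) (p q : Chat R) (z w : R[i]).

(* The null vector representing p: <c, nul p> is positive inside c, zero on c. *)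
Definition nul p : 'cV[R]_4 :=
  if p is Some z
  then vec4 (complex.Re z ^+ 2 + complex.Im z ^+ 2) 1 (complex.Re z) (complex.Im z)
  else vec4 1 0 0 0.

Lemma ip_nul_None c : ip c (nul None) = - curv c / 2.
Proof. by rewrite /ip /nul !coordE; ring. Qed.

Lemma ip_nul_Some c z : ip c (nul (Some z)) =
  h1 c * complex.Re z + h2 c * complex.Im z
  - (cocurv c + curv c * (complex.Re z ^+ 2 + complex.Im z ^+ 2)) / 2.
Proof. by rewrite /ip /nul !coordE; ring. Qed.

Lemma sqr_norm_lt z k : 0 < k ->
  (`|z| < k%:C) = (complex.Re z ^+ 2 + complex.Im z ^+ 2 < k ^+ 2).
Proof.
move=> k0; rewrite normc_def ltcR -[X in _ < X](gtr0_norm k0) -sqrtr_sqr.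
by rewrite ltr_sqrt // exprn_gt0.
Qed.

Lemma sqr_norm_gt z k : 0 < k ->
  (k%:C < `|z|) = (k ^+ 2 < complex.Re z ^+ 2 + complex.Im z ^+ 2).
Proof.
move=> k0; rewrite normc_def ltcR -[X in X < _](gtr0_norm k0) -sqrtr_sqr.
set S := _ ^+ 2 + _; have S0 : 0 <= S by rewrite addr_ge0 ?sqr_ge0.
by rewrite -(@ltr_pXn2r _ 2) ?nnegrE ?sqrtr_ge0 // !sqr_sqrtr ?sqr_ge0.
Qed.

Lemma sqr_norm_le z k : 0 <= k ->
  (`|z| <= k%:C) = (complex.Re z ^+ 2 + complex.Im z ^+ 2 <= k ^+ 2).
Proof.
move=> k0; rewrite normc_def lecR -[X in _ <= X](ger0_norm k0) -sqrtr_sqr.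
by rewrite ler_sqrt // sqr_ge0.
Qed.

Lemma sqr_norm_eq z k : 0 <= k ->
  (`|z| = k%:C) <-> (complex.Re z ^+ 2 + complex.Im z ^+ 2 = k ^+ 2).
Proof.
move=> k0; rewrite normc_def.
set S := _ ^+ 2 + _; have S0 : 0 <= S by rewrite addr_ge0 ?sqr_ge0.
split=> [[<-]|->]; first by rewrite sqr_sqrtr.
by rewrite sqrtr_sqr ger0_norm.
Qed.

Lemma Re_Im_center c z :
  (complex.Re (z - center c) = complex.Re z - h1 c / curv c) *
  (complex.Im (z - center c) = complex.Im z - h2 c / curv c).
Proof.
rewrite /center /cnorm /h1 /h2; set k := curv c.
have [k0|k0] := eqVneq k 0.
  by rewrite k0 !invr0 !mulr0; case: z => a b /=; rewrite !subr0.
suff -> : (c (inord 2) 0 +i* c (inord 3) 0) / k%:C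
    = (c (inord 2) 0 / k) +i* (c (inord 3) 0 / k) by case: z.
apply: (mulIf (_ : k%:C != 0)); first by rewrite eq_complex /= negb_and k0.
rewrite divfK; last by rewrite eq_complex /= negb_and k0.
by rewrite /GRing.mul /= !mulr0 subr0 add0r !divfK.
Qed.

(** For b = [curv c] nonzero and a finite point, completing the square shows that twice the pairing
    is b times the excess of 1/b^2 over the squared distance to the center; the sign of b accounts
    for the orientation. *)
Lemma in_interior c p : is_ocircle c ->
  circle_interior c p <-> 0 < ip c (nul p).
Proof.
move=> /ocircle_ip cc; rewrite /circle_interior /mkset.
have {}cc : h1 c ^+ 2 + h2 c ^+ 2 = 1 + cocurv c * curv c by rewrite /ip in cc; lra.
case: ifPn => [k0|]; last first.
  rewrite -leNgt le_eqVlt => /orP[/eqP k0|k0].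
    rewrite k0 ltxx; case: p => [z|] /=; last by rewrite ip_nul_None k0 oppr0 mul0r ltxx.
    rewrite ip_nul_Some k0 /dotC /= /h1 /h2; by split=> h; lra.
  rewrite k0; case: p => [z|] /=; last first.
    by split=> // _; rewrite ip_nul_None divr_gt0 // oppr_gt0.
  rewrite ltr0_norm ?invr_lt0 // sqr_norm_gt ?oppr_gt0 ?invr_lt0 //.
  rewrite !Re_Im_center ip_nul_Some sqrrN exprVn.
  set a := complex.Re z; set b := complex.Im z.
  have E : 2 * (h1 c * a + h2 c * b - (cocurv c + curv c * (a ^+ 2 + b ^+ 2)) / 2)
    = - curv c * ((a - h1 c / curv c) ^+ 2 + (b - h2 c / curv c) ^+ 2 - (curv c ^+ 2)^-1).
    have -> : cocurv c = (h1 c ^+ 2 + h2 c ^+ 2 - 1) / curv c.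
      by rewrite cc; field; exact: ltr0_neq0.
    by field; exact: ltr0_neq0.
  by rewrite -[0 < _ - _](pmulr_rgt0 _ (ltr0n _ 2)) E pmulr_rgt0 ?oppr_gt0 // subr_gt0.
case: p => [z|] /=; last first.
  by split=> // ; rewrite ip_nul_None pmulr_lgt0 ?invr_gt0 ?ltr0n // oppr_gt0 ltNge ltW.
rewrite sqr_norm_lt ?invr_gt0 // !Re_Im_center ip_nul_Some exprVn.
set a := complex.Re z; set b := complex.Im z.
have E : 2 * (h1 c * a + h2 c * b - (cocurv c + curv c * (a ^+ 2 + b ^+ 2)) / 2)
  = curv c * ((curv c ^+ 2)^-1 - ((a - h1 c / curv c) ^+ 2 + (b - h2 c / curv c) ^+ 2)).
  have -> : cocurv c = (h1 c ^+ 2 + h2 c ^+ 2 - 1) / curv c.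
    by rewrite cc; field; exact: lt0r_neq0.
  by field; exact: lt0r_neq0.
by rewrite -[0 < _ - _](pmulr_rgt0 _ (ltr0n _ 2)) E pmulr_rgt0 // subr_gt0.
Qed.

Lemma in_circle c p : is_ocircle c -> circle c p <-> ip c (nul p) = 0.
Proof.
move=> /ocircle_ip cc; rewrite /circle /mkset.
have {}cc : h1 c ^+ 2 + h2 c ^+ 2 = 1 + cocurv c * curv c by rewrite /ip in cc; lra.
case: eqVneq => [k0|k0].
  case: p => [z|]; last by rewrite ip_nul_None k0 oppr0 mul0r.
  by rewrite ip_nul_Some k0 /dotC /= /h1 /h2; split=> h; lra.
case: p => [z|] /=; last first.
  rewrite ip_nul_None; split=> // /eqP; rewrite mulf_eq0 oppr_eq0 (negbTE k0) /=.
  by rewrite invr_eq0 (@pnatr_eq0 R 2).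
rewrite sqr_norm_eq ?normr_ge0 // !Re_Im_center ip_nul_Some.
rewrite -normrX exprVn ger0_norm ?invr_ge0 ?sqr_ge0 //.
set a := complex.Re z; set b := complex.Im z.
have E : 2 * (h1 c * a + h2 c * b - (cocurv c + curv c * (a ^+ 2 + b ^+ 2)) / 2)
  = curv c * ((curv c ^+ 2)^-1 - ((a - h1 c / curv c) ^+ 2 + (b - h2 c / curv c) ^+ 2)).
  have -> : cocurv c = (h1 c ^+ 2 + h2 c ^+ 2 - 1) / curv c by rewrite cc; field.
  by field.
split=> h; last first.
  by move: E; rewrite h mulr0 => /esym/eqP; rewrite mulf_eq0 (negbTE k0) /= subr_eq0 => /eqP.
by rewrite h subrr mulr0 in E; lra.
Qed.

(** Inversion is the action of the reflection on null rays. The factor [k] is the [curv] coordinate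
    of the reflected vector, or its [cocurv] coordinate when the image is infinity. *)
Lemma nul_inversion d p : is_ocircle d ->
  exists2 k, 0 < k & refl d (nul p) = k *: nul (inversion d p).
Proof.
move=> /ocircle_ip dd.
have {}dd : h1 d ^+ 2 + h2 d ^+ 2 = 1 + cocurv d * curv d by rewrite /ip in dd; lra.
rewrite /inversion; case: eqVneq => [k0|k0].
  exists 1 => //; rewrite scale1r /refl.
  rewrite k0 mulr0 addr0 in dd.
  case: p => [z|]; last first.
    by rewrite ip_nul_None k0 oppr0 mul0r mulr0 scale0r subr0.
  rewrite ip_nul_Some k0 /= /dotC /= -/(h1 d) -/(h2 d).
  set a := complex.Re z; set b := complex.Im z; rewrite mul0r addr0.
  have -> : z - (2 * (h1 d * a + h2 d * b - cocurv d / 2))%:C * cnorm d =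
    (a - 2 * (h1 d * a + h2 d * b - cocurv d / 2) * h1 d) +i*
    (b - 2 * (h1 d * a + h2 d * b - cocurv d / 2) * h2 d).
    rewrite /a /b; case: z a b => a b _ _; rewrite /cnorm -/(h1 d) -/(h2 d) /=.
    by apply/eqP; rewrite eq_complex /= !mul0r subr0 addr0 !eqxx.
  apply: vec4P; rewrite /= !coordE // ?k0 ?mulr0 ?subr0 //.
  set t := _ - cocurv d / 2.
  rewrite (_ : cocurv d = 2 * (h1 d * a + h2 d * b - t)); last by rewrite /t; field.
  transitivity (a ^+ 2 + b ^+ 2 - 4 * t * (h1 d * a + h2 d * b) + 4 * t ^+ 2
      * (h1 d ^+ 2 + h2 d ^+ 2)).
    by rewrite dd; ring.
  by ring.
case: p => [z|]; last first.
  exists (curv d ^+ 2); first by rewrite exprn_even_gt0.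
  have cen : center d = (h1 d / curv d) +i* (h2 d / curv d).
    have := Re_Im_center d 0; case: (center d) => a b /= [].
    by rewrite !sub0r => /oppr_inj -> /oppr_inj ->.
  rewrite cen /refl ip_nul_None; apply: vec4P; rewrite /= !coordE.
  - have -> : cocurv d = (h1 d ^+ 2 + h2 d ^+ 2 - 1) / curv d by rewrite dd; field.
    by field.
  - by field.
  - by field.
  - by field.
have cen : center d = (h1 d / curv d) +i* (h2 d / curv d).
  have := Re_Im_center d 0; case: (center d) => a b /= [].
  by rewrite !sub0r => /oppr_inj -> /oppr_inj ->.
have cod : cocurv d = (h1 d ^+ 2 + h2 d ^+ 2 - 1) / curv d by rewrite dd; field.
case: eqVneq => [->|zc].
  exists (curv d ^- 2); first by rewrite invr_gt0 exprn_even_gt0.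
  rewrite /refl ip_nul_Some cen /=.
  by apply: vec4P; rewrite /= !coordE cod; field.
move: zc; rewrite cen; case: z => a b /=; rewrite eq_complex /= negb_and.
set A := a - h1 d / curv d; set B := b - h2 d / curv d => zc.
have AB : 0 < A ^+ 2 + B ^+ 2.
  case/orP: zc; rewrite -subr_eq0 => h.
    by apply: ltr_wpDr; rewrite ?sqr_ge0 // exprn_even_gt0.
  by apply: ltr_wpDl; rewrite ?sqr_ge0 // exprn_even_gt0.
exists (curv d ^+ 2 * (A ^+ 2 + B ^+ 2)).
  by rewrite mulr_gt0 // exprn_even_gt0.
have AB0 := lt0r_neq0 AB; rewrite /refl /ip !coordE.
have -> : a = A + h1 d / curv d by rewrite /A subrK.
have -> : b = B + h2 d / curv d by rewrite /B subrK.
by apply: vec4P; rewrite /= !coordE ?cod; field; rewrite ?sqrrN ?k0 ?AB0.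
Qed.

End Sphere.

(** * Oriented circles with disjoint interiors *)

Section DisjointInteriors.
Variable R : realType.
Implicit Types (x y u v c d : 'cV[R]_4) (a b k : R) (p q : Chat R) (z w : R[i]).

(** The zero vector gets an arbitrary unit direction, so that concentric circles need no separate
    treatment. *)
Lemma polar_decomposition (v1 v2 : R) : exists D e1 e2 : R,
  [/\ 0 <= D, e1 ^+ 2 + e2 ^+ 2 = 1, v1 = D * e1 & v2 = D * e2].
Proof.
have [v0|v0] := eqVneq (v1 ^+ 2 + v2 ^+ 2) 0.
  exists 0, 1, 0; split; rewrite ?mul0r ?expr1n ?expr0n ?addr0 //.
    by apply/eqP; move/eqP: v0; rewrite paddr_eq0 ?sqr_ge0 // !sqrf_eq0 => /andP[].
  by apply/eqP; move/eqP: v0; rewrite paddr_eq0 ?sqr_ge0 // !sqrf_eq0 => /andP[].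
have S0 : 0 <= v1 ^+ 2 + v2 ^+ 2 by rewrite addr_ge0 ?sqr_ge0.
set D := Num.sqrt (v1 ^+ 2 + v2 ^+ 2).
have D0 : D != 0 by rewrite sqrtr_eq0 -ltNge lt_neqAle eq_sym v0.
have D2 : D ^+ 2 = v1 ^+ 2 + v2 ^+ 2 by rewrite sqr_sqrtr.
exists D, (v1 / D), (v2 / D); split; rewrite ?sqrtr_ge0 //.
- by rewrite !expr_div_n -mulrDl -D2 divff // expf_neq0.
- by rewrite mulrC divfK.
- by rewrite mulrC divfK.
Qed.

Lemma future_of_curv_gt0 u : 0 < curv u -> ip u u <= 0 -> future u.
Proof.
move=> u1 uu; split; [|exact: ltW|exact: uu]; rewrite -(pmulr_rge0 _ u1).
by rewrite /ip in uu; have := sqr_ge0 (h1 u); have := sqr_ge0 (h2 u); lra.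
Qed.

(** The cases are the signs of the two curvatures; a pairing above -1 would give an explicit point
    common to both interiors. As [c + d] has norm 2 + 2<c,d>, it then lies in the light cone, and
    the sign of its curvature selects the half; total curvature 0 is settled separately. *)
Lemma disjoint_interiors_ip c d : is_ocircle c -> is_ocircle d ->
  disjoint_interiors c d -> ip c d <= -1 /\ future (c + d).
Proof.
wlog le_dc : c d / curv d <= curv c.
  move=> H oc od cd; have [/H|/ltW/H] := leP (curv d) (curv c); first exact.
  by rewrite ipC addrC; apply=> //; rewrite /disjoint_interiors setIC.
move=> oc od cd.
have Hp p : 0 < ip c (nul p) -> 0 < ip d (nul p) -> False.
  move=> /(in_interior _ oc) pc /(in_interior _ od) pd.
  by have : set0 p by rewrite -cd.
have cc := oc; rewrite ocircle_ip /ip in cc.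
have dd := od; rewrite ocircle_ip /ip in dd.
have uu : ip (c + d) (c + d) = 2 + 2 * ip c d by rewrite /ip !coordE; lra.
have H a b : 0 < 2 * (h1 c * a + h2 c * b) - cocurv c - curv c * (a ^+ 2 + b ^+ 2) ->
  0 < 2 * (h1 d * a + h2 d * b) - cocurv d - curv d * (a ^+ 2 + b ^+ 2) -> False.
  by move=> ? ?; apply: (Hp (Some (a +i* b))); rewrite ip_nul_Some /=; lra.
have := Hp None; rewrite !ip_nul_None => HN.
have {cd Hp oc od} HN : curv c < 0 -> curv d < 0 -> False.
  by move=> ? ?; apply: HN; lra.
have fut : 0 < curv c + curv d -> ip c d <= -1 -> future (c + d).
  by move=> u1 L1; apply: future_of_curv_gt0; rewrite ?coordE // uu; lra.
rewrite /ip in uu fut *; rewrite !coordE in uu.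
set c1 := curv c in le_dc cc uu fut H HN *; set d1 := curv d in le_dc dd uu fut H HN *.
set c0 := cocurv c in cc uu H *; set d0 := cocurv d in dd uu fut H *.
set p1 := h1 c in cc uu H *; set p2 := h2 c in cc uu fut H *.
set q1 := h1 d in dd uu H *; set q2 := h2 d in dd uu fut H *.
set L := p1 * q1 + p2 * q2 - (c0 * d1 + c1 * d0) / 2 in uu fut *.
case: (ltrgt0P d1) => d1s.
- have c1s : 0 < c1 by lra.
  have u1 : 0 < c1 + d1 by lra.
  suff L1 : L <= -1.
    by split=> //; apply: fut => //; lra.
  have [//|L1] := leP L (-1); exfalso.
  (* This is the mean of the centers weighted by the curvatures, the point of contact when the discs
     are tangent. *)
  apply: (H ((p1 + q1) / (c1 + d1)) ((p2 + q2) / (c1 + d1))).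
    rewrite [ltRHS](_ : _ = 2 * (1 + L) * d1 / (c1 + d1) ^+ 2).
      by rewrite divr_gt0 ?mulr_gt0 ?exprn_gt0 //; lra.
    rewrite /L; have -> : c0 = (p1 ^+ 2 + p2 ^+ 2 - 1) / c1.
      by apply: (mulIf (lt0r_neq0 c1s)); rewrite divfK ?lt0r_neq0 //; lra.
    have -> : d0 = (q1 ^+ 2 + q2 ^+ 2 - 1) / d1.
      by apply: (mulIf (lt0r_neq0 d1s)); rewrite divfK ?lt0r_neq0 //; lra.
    by field; rewrite !lt0r_neq0.
  rewrite [ltRHS](_ : _ = 2 * (1 + L) * c1 / (c1 + d1) ^+ 2).
    by rewrite divr_gt0 ?mulr_gt0 ?exprn_gt0 //; lra.
  rewrite /L; have -> : c0 = (p1 ^+ 2 + p2 ^+ 2 - 1) / c1.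
    by apply: (mulIf (lt0r_neq0 c1s)); rewrite divfK ?lt0r_neq0 //; lra.
  have -> : d0 = (q1 ^+ 2 + q2 ^+ 2 - 1) / d1.
    by apply: (mulIf (lt0r_neq0 d1s)); rewrite divfK ?lt0r_neq0 //; lra.
  by field; rewrite !lt0r_neq0.
- case: (ltrgt0P c1) => c1s.
  + have c0E : c0 = (p1 ^+ 2 + p2 ^+ 2 - 1) / c1.
      by apply: (mulIf (lt0r_neq0 c1s)); rewrite divfK ?lt0r_neq0 //; lra.
    have d0E : d0 = (q1 ^+ 2 + q2 ^+ 2 - 1) / d1.
      by apply: (mulIf (ltr0_neq0 d1s)); rewrite divfK ?ltr0_neq0 //; lra.
    set r := c1^-1; set s := - d1^-1.
    have r0 : 0 < r by rewrite invr_gt0.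
    have s0 : 0 < s by rewrite oppr_gt0 invr_lt0.
    have c1E : c1 = r^-1 by rewrite invrK.
    have d1E : d1 = - s^-1 by rewrite /s invrN invrK opprK.
    clearbody r s.
    have c1n := lt0r_neq0 c1s; have d1n := ltr0_neq0 d1s.
    have [D [e1 [e2 [D0 e12 v1 v2]]]] :=
      polar_decomposition (p1 / c1 - q1 / d1) (p2 / c1 - q2 / d1).
    have p1E : p1 = q1 * c1 / d1 + c1 * (D * e1).
      by rewrite -v1; field; rewrite c1n d1n.
    have p2E : p2 = q2 * c1 / d1 + c1 * (D * e2).
      by rewrite -v2; field; rewrite c1n d1n.
    (* [D] is the distance of the centers. If the disc [c] were not contained in the disc of radius
       [s] bounded by [d], a point at distance [t] from the center of [c], in the direction away
       from the center of [d], would lie in both interiors. *)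
    have Drs : D + r <= s.
      rewrite leNgt; apply/negP => Drs.
      have [t [t0 tr ts]] : exists t, [/\ 0 <= t, t < r & s < D + t].
        have [sD|Ds] := ltP s D; first by exists 0; split=> //; lra.
        by exists ((s - D + r) / 2); split; lra.
      apply: (H (p1 / c1 + t * e1) (p2 / c1 + t * e2)).
        rewrite [ltRHS](_ : _ = r^-1 * ((r - t) * (r + t))).
          by rewrite !mulr_gt0 ?invr_gt0 //; lra.
        rewrite c0E c1E; transitivity (r - r^-1 * (t ^+ 2 * (e1 ^+ 2 + e2 ^+ 2))).
          by field; rewrite lt0r_neq0.
        by rewrite e12; field; rewrite lt0r_neq0.
      rewrite [ltRHS](_ : _ = s^-1 * ((D + t - s) * (D + t + s))).
        by rewrite !mulr_gt0 ?invr_gt0 //; lra.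
      rewrite d0E p1E p2E d1E c1E.
      transitivity (s^-1 * ((D + t) ^+ 2 * (e1 ^+ 2 + e2 ^+ 2)) - s).
        by field; rewrite !lt0r_neq0.
      by rewrite e12; field; rewrite lt0r_neq0.
    have LE : L = (D ^+ 2 - r ^+ 2 - s ^+ 2) / (2 * r * s).
      rewrite /L c0E d0E p1E p2E d1E c1E.
      transitivity ((D ^+ 2 * (e1 ^+ 2 + e2 ^+ 2) - r ^+ 2 - s ^+ 2) / (2 * r * s)).
        by field; rewrite !lt0r_neq0.
      by rewrite e12 mulr1.
    have L1 : L <= -1.
      rewrite LE ler_pdivrMr ?mulr_gt0 //.
      suff : D ^+ 2 <= (s - r) ^+ 2 by lra.
      by rewrite ler_sqr ?nnegrE //; lra.
    split=> //.
    have rs : r <= s by lra.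
    have [rs'|] := ltP r s.
      by apply: fut => //; rewrite -/c1 -/d1 c1E d1E subr_gt0 ltf_pV2.
    (* Equal radii leave only one circle with its two orientations, and [c + d] vanishes. *)
    move=> sr; have rsE : r = s by lra.
    have DE : D = 0 by lra.
    rewrite /future /ip !coordE -/c0 -/c1 -/d1 -/d0 -/p1 -/p2 -/q1 -/q2.
    split; [|by rewrite c1E d1E rsE; lra|lra].
    rewrite c0E d0E p1E p2E DE d1E c1E rsE le_eqVlt; apply/orP; left; apply/eqP.
    by field; rewrite lt0r_neq0.
  + by case: (HN c1s d1s).
  + exfalso.
    set q := q1 * p1 + q2 * p2.
    have pp : p1 ^+ 2 + p2 ^+ 2 = 1 by rewrite c1s in cc; lra.
    set A := - d1; have A0 : 0 < A by rewrite oppr_gt0.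
    set B := `|2 * q| + `|d0| + 1.
    have [q1' q2'] : - `|2 * q| <= 2 * q /\ 2 * q <= `|2 * q|.
      by split; rewrite ?ler_norm // lerNl -normrN ler_norm.
    have d0n := ler_norm d0; have c0n := ler_norm c0.
    have B0 : 0 < B / A by rewrite divr_gt0 // /B -addrA ltr_wpDl // ltr_wpDl.
    (* Points far out along the normal of the half-plane [c] are outside the disc bounded by [d]:
       [t] is large enough for the quadratic term to outweigh the others. *)
    set t := 1 + `|c0| + B / A; have tE : t = 1 + `|c0| + B / A by [].
    have c0n' := normr_ge0 c0; have d0n' := normr_ge0 d0.
    have t1 : 1 <= t by rewrite tE; move: (B / A) B0 => X X0; lra.
    have tA : B < t * A.
      by rewrite /t mulrDl divfK ?lt0r_neq0 // ltrDr mulr_gt0 //; apply: ltr_wpDr.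
    apply: (H (t * p1) (t * p2)).
      rewrite c1s mul0r subr0.
      rewrite [ltRHS](_ : _ = 2 * t * (p1 ^+ 2 + p2 ^+ 2) - c0); last by ring.
      by rewrite pp mulr1 subr_gt0 (le_lt_trans c0n) // tE; move: (B / A) B0 => X X0; lra.
    rewrite [ltRHS](_ : _ = t * (2 * q) - d0 + t * A * (t * (p1 ^+ 2 + p2 ^+ 2)));
      last by rewrite /A /q; ring.
    rewrite pp mulr1.
    have : t * (- `|2 * q|) <= t * (2 * q) by rewrite ler_pM2l //; lra.
    have : B * t < t * A * t by rewrite ltr_pM2r //; lra.
    have : `|d0| <= `|d0| * t by rewrite ler_peMr.
    rewrite /B; lra.
- case: (ltrgt0P c1) => c1s.
  + suff L1 : L <= -1.
      by split=> //; apply: fut => //; lra.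
    have [//|L1] := leP L (-1); exfalso.
    have qq : q1 ^+ 2 + q2 ^+ 2 = 1 by rewrite d1s in dd; lra.
    have c0E : c0 = (p1 ^+ 2 + p2 ^+ 2 - 1) / c1.
      by apply: (mulIf (lt0r_neq0 c1s)); rewrite divfK ?lt0r_neq0 //; lra.
    (* The center of [c] is moved by [t] radii along the unit normal of [d]. This requires t < 1 and
       L + t > 0; the second holds because L(2 + L) + 1 = (L + 1)^2. *)
    set t := (2 + L)^-1.
    have t0 : 0 < t by rewrite invr_gt0; lra.
    have t1 : t < 1 by rewrite invf_lt1; lra.
    have tL : 0 < L + t.
      rewrite -(pmulr_rgt0 _ (_ : 0 < 2 + L)); last by lra.
      rewrite mulrDr mulfV ?lt0r_neq0 //; last by lra.
      rewrite [ltRHS](_ : _ = (L + 1) ^+ 2); last by ring.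
      by rewrite exprn_gt0 //; lra.
    apply: (H ((p1 + t * q1) / c1) ((p2 + t * q2) / c1)).
      rewrite [ltRHS](_ : _ = (1 - t ^+ 2 * (q1 ^+ 2 + q2 ^+ 2)) / c1); last first.
        by rewrite c0E; field; rewrite lt0r_neq0.
      rewrite qq mulr1 divr_gt0 // subr_gt0 expr_lt1 // ltW //.
    rewrite [ltRHS](_ : _ = 2 * ((p1 * q1 + p2 * q2 - c1 * d0 / 2
      + t * (q1 ^+ 2 + q2 ^+ 2))) / c1); last first.
      by rewrite d1s; field; rewrite lt0r_neq0.
    rewrite qq mulr1 divr_gt0 // mulr_gt0 //.
    by rewrite /L d1s in tL; lra.
  + by exfalso; lra.
  + have pp : p1 ^+ 2 + p2 ^+ 2 = 1 by rewrite c1s in cc; lra.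
    have qq : q1 ^+ 2 + q2 ^+ 2 = 1 by rewrite d1s in dd; lra.
    have L1 : L <= -1.
      rewrite leNgt; apply/negP => L1; have L0 : 0 < 1 + L by lra.
      have LE : L = p1 * q1 + p2 * q2 by rewrite /L c1s d1s; lra.
      set t := (`|c0| + `|d0| + 1) / (1 + L).
      have tL : t * (1 + L) = `|c0| + `|d0| + 1 by rewrite divfK ?lt0r_neq0.
      have d0n := ler_norm d0; have c0n := ler_norm c0.
      have d0n' := normr_ge0 d0; have c0n' := normr_ge0 c0.
      apply: (H (t * (p1 + q1)) (t * (p2 + q2))).
        rewrite c1s mul0r subr0 [ltRHS](_ : _ =
          2 * (t * (p1 ^+ 2 + p2 ^+ 2 + (p1 * q1 + p2 * q2))) - c0); last by ring.
        by rewrite pp -LE tL; lra.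
      rewrite d1s mul0r subr0 [ltRHS](_ : _ =
        2 * (t * (q1 ^+ 2 + q2 ^+ 2 + (p1 * q1 + p2 * q2))) - d0); last by ring.
      by rewrite qq -LE tL; lra.
    split=> //; rewrite /future /ip !coordE -/c0 -/c1 -/d1 -/d0 -/p1 -/p2 -/q1 -/q2.
    split; [|by rewrite c1s d1s addr0|lra].
    have z0 : (p1 + q1) ^+ 2 + (p2 + q2) ^+ 2 <= 0 by rewrite /L c1s d1s in L1; lra.
    have z1 := sqr_ge0 (p1 + q1); have z2 := sqr_ge0 (p2 + q2).
    have e1 : q1 = - p1.
      have /eqP : (p1 + q1) ^+ 2 = 0 by lra.
      by rewrite sqrf_eq0 => /eqP; lra.
    have e2 : q2 = - p2.
      have /eqP : (p2 + q2) ^+ 2 = 0 by lra.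
      by rewrite sqrf_eq0 => /eqP; lra.
    rewrite leNgt; apply/negP => u0.
    have tp : 2 * (p1 * ((c0 - d0) / 4 * p1) + p2 * ((c0 - d0) / 4 * p2)) = (c0 - d0) / 2.
      transitivity ((c0 - d0) / 2 * (p1 ^+ 2 + p2 ^+ 2)); first by field.
      by rewrite pp mulr1.
    (* The normals are opposite, and a negative sum of the [cocurv] would make the half-planes
       overlap in a strip, whose midline contains this point. *)
    apply: (H ((c0 - d0) / 4 * p1) ((c0 - d0) / 4 * p2)).
      by rewrite tp c1s mul0r; lra.
    by rewrite e1 e2 d1s mul0r; lra.
Qed.

End DisjointInteriors.

(** * Equal, orthogonal, tangent and disjoint circles *)

Section SphereTheory.
Variable R : realType.
Implicit Types (x y u v c d : 'cV[R]_4) (a b k : R) (p q : Chat R) (z w : R[i]).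

Lemma ocircleN c : is_ocircle c -> is_ocircle (- c).
Proof. by rewrite !ocircle_ip !ipE opprK. Qed.

(** If the interiors agree, then [c] and [- d] have disjoint interiors, which puts [c - d] in the
    cone; by symmetry its opposite is there too. *)
Lemma circle_interior_inj c d : is_ocircle c -> is_ocircle d ->
  circle_interior c = circle_interior d -> c = d.
Proof.
have half (e f : 'cV[R]_4) : is_ocircle e -> is_ocircle f ->
    circle_interior e = circle_interior f -> future (e - f).
  move=> oe of' ef.
  suff /(disjoint_interiors_ip oe (ocircleN of'))[] : disjoint_interiors e (- f) by [].
  rewrite /disjoint_interiors ef -subset0 => p [/(in_interior _ of') h].
  by move=> /(in_interior _ (ocircleN of')); rewrite ipNl oppr_gt0 ltNge ltW.
move=> oc od cd; apply/eqP; rewrite -subr_eq0; apply/eqP; apply: future_anti.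
  exact: half.
by rewrite opprB; apply: half.
Qed.

Lemma nul_inj p q k : nul p = k *: nul q -> p = q.
Proof.
move=> e; have /= := congr1 (@curv R) e; have /= := congr1 (@h1 R) e.
have /= := congr1 (@h2 R) e; have /= := congr1 (@cocurv R) e.
rewrite /nul; case: p q {e} => [[a b]|] [[a' b']|]; rewrite !coordE //=.
- by rewrite mulr1 => _ -> -> <-; rewrite !mul1r.
- by move=> _ _ _ /eqP; rewrite mulr0 oner_eq0.
- by rewrite mulr1 => + _ _ k0 => /eqP; rewrite -k0 mul0r oner_eq0.
Qed.

Lemma inversionK d : is_ocircle d -> involutive (inversion d).
Proof.
move=> od p; have [k k0 e] := nul_inversion p od.
have [l l0 f] := nul_inversion (inversion d p) od.
have := reflK (nul p) (proj1 (ocircle_ip d) od).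
rewrite e (_ : k *: _ = k *: nul (inversion d p) + 0) ?addr0 //.
rewrite -[k *: _]addr0 refl_is_linear f scalerA.
by rewrite /refl ip0r mulr0 scale0r subr0 addr0 => /esym/nul_inj.
Qed.

(** At a common point, the pairing of the circles equals the dot product of their normals. *)
Lemma orthogonal_circles_ip c d : is_ocircle c -> is_ocircle d ->
  orthogonal_circles c d -> ip c d = 0.
Proof.
move=> oc od [[z [zc zd]] /(_ z zc zd)].
move: zc zd => /(in_circle _ oc) + /(in_circle _ od).
rewrite !ip_nul_Some /normal_at /dotC /cnorm /ip.
rewrite -/(h1 c) -/(h2 c) -/(h1 d) -/(h2 d); case: z => a b /=.
rewrite !mul0r subr0 addr0 => C D.
have -> : cocurv c = 2 * (h1 c * a + h2 c * b) - curv c * (a ^+ 2 + b ^+ 2) by lra.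
have -> : cocurv d = 2 * (h1 d * a + h2 d * b) - curv d * (a ^+ 2 + b ^+ 2) by lra.
by move=> <-; field.
Qed.

Lemma circleN d : is_ocircle d -> circle (- d) = circle d.
Proof.
move=> od; rewrite eqEsubset; split=> p; rewrite !in_circle ?ipNl //;
  try exact: ocircleN.
  by move/eqP; rewrite oppr_eq0 => /eqP.
by move=> ->; rewrite oppr0.
Qed.

(** Two points suffice to show that a circle is neither tangent to nor disjoint from its own
    reverse. *)
Lemma circle_two_points c : is_ocircle c ->
  exists p q, [/\ p <> q, circle c p & circle c q].
Proof.
move=> oc; have := oc; rewrite ocircle_ip /ip => cc.
have [c0|c0] := eqVneq (curv c) 0.
  exists None, (Some ((cocurv c / 2 * h1 c) +i* (cocurv c / 2 * h2 c))).
  split; rewrite // in_circle // ?ip_nul_None ?ip_nul_Some /= c0 ?oppr0 ?mul0r //.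
  transitivity (cocurv c / 2 * (h1 c * h1 c + h2 c * h2 c - 1)); first by field.
  by rewrite (_ : _ - 1 = 0) ?mulr0 //; rewrite c0 in cc; lra.
have co : cocurv c = (h1 c ^+ 2 + h2 c ^+ 2 - 1) / curv c.
  by apply: (mulIf c0); rewrite divfK //; lra.
exists (Some (((h1 c + 1) / curv c) +i* (h2 c / curv c))).
exists (Some (((h1 c - 1) / curv c) +i* (h2 c / curv c))).
split; last 2 first.
- by rewrite in_circle // ip_nul_Some /= co; field.
- by rewrite in_circle // ip_nul_Some /= co; field.
by case=> /(mulIf (invr_neq0 c0)); lra.
Qed.

Lemma tangent_neqN c d : is_ocircle c -> tangent c d -> c + d <> 0.
Proof.
move=> oc [r e] /eqP; rewrite addrC addr_eq0 => /eqP dE; move: e.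
have [p [q [pq cp cq]]] := circle_two_points oc.
rewrite dE circleN // setIid => e; rewrite e in cp cq.
by apply: pq; rewrite cp cq.
Qed.

Lemma disjoint_neqN c d : is_ocircle c -> disjoint_circles c d -> c + d <> 0.
Proof.
move=> oc + /eqP; rewrite addrC addr_eq0 => + /eqP dE.
have [p [q [pq cp cq]]] := circle_two_points oc.
by rewrite /disjoint_circles dE circleN // setIid => e; rewrite e in cp.
Qed.

(* If <c, d> = -1 then c + d is null, hence spanned by the null vector of a
   common point of the two circles. *)
Lemma disjoint_circles_ip c d : is_ocircle c -> is_ocircle d ->
  disjoint_circles c d -> ip c d <> -1.
Proof.
move=> oc od dcd cd1; have := disjoint_neqN oc dcd; apply.
have cc := proj1 (ocircle_ip c) oc; have dd := proj1 (ocircle_ip d) od.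
have uc : ip (c + d) c = 0 by rewrite ipDl cc ipC cd1 subrr.
have ud : ip (c + d) d = 0 by rewrite ipDl dd cd1 addrC subrr.
have uu : ip (c + d) (c + d) = 0 by rewrite ipDr uc ud addr0.
have Hp p k : c + d = k *: nul p -> k != 0 -> False.
  move=> e k0; suff : set0 p by [].
  rewrite -dcd; split; rewrite in_circle //.
    by apply: (mulfI k0); rewrite -ipZr -e ipC uc mulr0.
  by apply: (mulfI k0); rewrite -ipZr -e ipC ud mulr0.
have uuE : h1 (c + d) ^+ 2 + h2 (c + d) ^+ 2 = cocurv (c + d) * curv (c + d).
  by rewrite /ip in uu; lra.
have [u1|u1] := eqVneq (curv (c + d)) 0; last first.
  exfalso; apply: (Hp (Some ((h1 (c + d) / curv (c + d)) +i*
     (h2 (c + d) / curv (c + d)))) (curv (c + d))) => //.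
  apply: vec4P; rewrite /= [RHS]coordE vec4E.
  - rewrite !expr_div_n -mulrDl uuE; field; exact: u1.
  - by rewrite mulr1.
  - by rewrite mulrC divfK.
  - by rewrite mulrC divfK.
rewrite u1 mulr0 in uuE.
have e1 : h1 (c + d) = 0.
  by have := sqr_ge0 (h2 (c + d)); have := sqr_ge0 (h1 (c + d)); nra.
have e2 : h2 (c + d) = 0.
  by have := sqr_ge0 (h2 (c + d)); have := sqr_ge0 (h1 (c + d)); nra.
have uE : c + d = cocurv (c + d) *: nul None.
  by apply: vec4P; rewrite ?u1 ?e1 ?e2 /= [RHS]coordE vec4E ?mulr0 ?mulr1.
have [u0|u0] := eqVneq (cocurv (c + d)) 0; first by rewrite uE u0 scale0r.
by case: (Hp _ _ uE u0).
Qed.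

End SphereTheory.

(** * Words in involutions, and reduced words *)

Section Words.
Variables (T I : Type) (f : I -> T -> T).

(* The first letter of a word acts first. *)
Definition wmap (t : seq I) (x : T) : T := foldl (fun y j => f j y) x t.

Lemma wmap_cat s t x : wmap (s ++ t) x = wmap t (wmap s x).
Proof. by rewrite /wmap foldl_cat. Qed.

Hypothesis fK : forall i, involutive (f i).

Lemma wmap_revK t x : wmap (rev t) (wmap t x) = x.
Proof.
elim: t x => //= i t IH x; rewrite rev_cons -cats1 wmap_cat IH /=; exact: fK.
Qed.

Lemma wmapK_rev t x : wmap t (wmap (rev t) x) = x.
Proof. by rewrite -{1}(revK t) wmap_revK. Qed.

(** A product of involutions is inverted by reversing the word, so words without formal inverses
    already form a group. *)
Lemma generated_groupP w : generated_group f w <-> exists t, w = wmap t.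
Proof.
split=> [|[t ->]].
  elim=> {w} [|i|u w _ [t ->] _ [s ->]|u w _ [t ->] _ wu].
  - by exists [::].
  - by exists [:: i].
  - by exists (s ++ t); apply: funext => x; rewrite wmap_cat.
  - exists (rev t); apply: funext => x.
    by rewrite -[in RHS](wu x) wmap_revK.
elim: t => [|i t IH]; first exact: gen_id.
exact: gen_comp IH (gen_gen f i).
Qed.

End Words.

Section ReducedWords.
Variable I : eqType.

Definition reduced (t : seq I) := sorted (fun i j => i != j) t.

(** A letter put in front of a reduced word either keeps it reduced or cancels against its first
    letter. *)
Lemma reduced_rep (T : Type) (f : I -> T -> T) :
  (forall i, involutive (f i)) ->
  forall t, exists2 s, reduced s & wmap f s = wmap f t.
Proof.
move=> fK; elim=> [|i t [s rs e]]; first by exists [::].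
have e' : wmap f (i :: t) = wmap f (i :: s) by apply: funext => x; rewrite /= -/(wmap f _ _) -e.
case: s => [|j s] in rs e e' *; first by exists [:: i].
have [ij|ij] := eqVneq i j; last by exists (i :: j :: s); rewrite // /reduced /= ij.
exists s; first exact: path_sorted rs.
by rewrite e'; apply: funext => x; rewrite /wmap /= ij fK.
Qed.

End ReducedWords.

(** * Positive lower bounds over finite index sets *)

Section LowerBounds.
Variable R : realType.

Lemma positive_lower_bound (I : finType) (f : I -> R) :
  (forall i, 0 < f i) -> exists2 delta, 0 < delta & forall i, delta <= f i.
Proof.
(* The default value 1 keeps the bound positive when [I] is empty. *)
move=> f0; exists (\big[Order.min/1]_j f j); last by move=> j; exact: bigmin_le_cond.
by rewrite lt_bigmin.
Qed.

(** This makes uniform the condition that at most one value vanishes. It serves both for the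
    curvatures of the walls and for the pairings of a point of the cone with the walls. *)
Lemma pair_lower_bound (I : finType) (f : I -> R) : (forall j, 0 <= f j) ->
  (forall j l, j != l -> f j = 0 -> f l = 0 -> False) ->
  exists2 delta, 0 < delta & forall j l, j != l -> delta <= f j + f l.
Proof.
move=> f0 f1.
pose g (p : I * I) := if p.1 != p.2 then f p.1 + f p.2 else 1.
have g0 p : 0 < g p.
  rewrite /g; case: ifPn => // p12; rewrite lt_neqAle addr_ge0 // andbT eq_sym.
  rewrite paddr_eq0 //; apply/negP => /andP[/eqP a /eqP b]; exact: f1 p12 a b.
have [delta delta0 H] := positive_lower_bound g0; exists delta => // j l jl.
by have := H (j, l); rewrite /g /= jl.
Qed.

End LowerBounds.

(** * The group generated by the reflections in the dual circles *)

Section DualGroup.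
Variables (R : realType) (n : nat) (d : 'I_n -> 'cV[R]_4).
Hypothesis od : forall j, is_ocircle (d j).
Hypothesis dd : forall j l, j != l -> ip (d j) (d l) <= -1 /\ future (d j + d l).
Hypothesis dN : forall j l, j != l -> d j + d l <> 0.
Implicit Types (t s : seq 'I_n) (i j l : 'I_n) (x y c : 'cV[R]_4).

Definition act t x := wmap (fun j => refl (d j)) t x.
Definition gact t p := wmap (fun j => inversion (d j)) t p.

Lemma ip_dual j : ip (d j) (d j) = 1.
Proof. by rewrite -ocircle_ip. Qed.

Lemma act_is_linear t : linear (act t).
Proof.
by elim: t => //= j t IH a x y; rewrite /act /= refl_is_linear; exact: IH.
Qed.

Lemma actD t x y : act t (x + y) = act t x + act t y.
Proof. by rewrite -{1}[x]scale1r act_is_linear scale1r. Qed.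

Lemma act0 t : act t 0 = 0.
Proof. by apply: (@addrI _ (act t 0)); rewrite -actD !addr0. Qed.

Lemma actZ t a x : act t (a *: x) = a *: act t x.
Proof. by rewrite -[a *: x]addr0 act_is_linear act0 addr0. Qed.

Lemma actN t x : act t (- x) = - act t x.
Proof. by rewrite -scaleN1r actZ scaleN1r. Qed.

Lemma act_cat s t x : act (s ++ t) x = act t (act s x).
Proof. exact: wmap_cat. Qed.

Lemma reflK_dual j : involutive (refl (d j)).
Proof. by move=> x; rewrite reflK // ip_dual. Qed.

Lemma inversionK_dual j : involutive (inversion (d j)).
Proof. exact: inversionK. Qed.

Lemma act_revK t x : act (rev t) (act t x) = x.
Proof. exact: (wmap_revK reflK_dual). Qed.

Lemma actK_rev t x : act t (act (rev t) x) = x.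
Proof. exact: (wmapK_rev reflK_dual). Qed.

Lemma ip_act t x y : ip (act t x) (act t y) = ip x y.
Proof.
by elim: t x y => //= j t IH x y; rewrite /act /= IH ip_refl // ip_dual.
Qed.

Lemma future_act t x : future x -> future (act t x).
Proof.
elim: t x => //= j t IH x fx; apply: IH; apply: future_refl => //; exact: ip_dual.
Qed.

Lemma ocircle_act t c : is_ocircle c -> is_ocircle (act t c).
Proof. by rewrite !ocircle_ip ip_act. Qed.

Lemma nul_gact t p : exists2 k, 0 < k & act t (nul p) = k *: nul (gact t p).
Proof.
elim: t p => [|j t IH] p; first by exists 1; rewrite ?scale1r.
have [k k0 e] := nul_inversion p (od j).
have [l l0 f] := IH (inversion (d j) p).
exists (k * l); first exact: mulr_gt0.
by rewrite /act /= e -/(act t _) actZ f scalerA.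
Qed.

Lemma ip_act_gact t c p : exists2 k, 0 < k &
  ip c (nul p) = k * ip (act t c) (nul (gact t p)).
Proof.
have [k k0 e] := nul_gact t p; exists k => //.
by rewrite -ipZr -e ip_act.
Qed.

Lemma circle_gact t c p : is_ocircle c ->
  circle (act t c) (gact t p) <-> circle c p.
Proof.
move=> oc; have oc' := ocircle_act t oc.
have [k k0 e] := ip_act_gact t c p; rewrite !in_circle // e.
split=> [->|/eqP]; first by rewrite mulr0.
by rewrite mulf_eq0 gt_eqF //= => /eqP.
Qed.

Lemma gact_cat s t : gact (s ++ t) = gact t \o gact s.
Proof. by apply: funext => p; rewrite /gact wmap_cat. Qed.

Lemma gact_revK t p : gact (rev t) (gact t p) = p.
Proof. exact: (wmap_revK inversionK_dual). Qed.

Lemma gactK_rev t p : gact t (gact (rev t) p) = p.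
Proof. exact: (wmapK_rev inversionK_dual). Qed.

Lemma gact_reduced t : exists2 s, reduced s & gact s = gact t.
Proof.
have [s rs e] := reduced_rep inversionK_dual t.
by exists s => //; apply: funext => p; rewrite /gact e.
Qed.

Lemma circle_interior_gact t c : is_ocircle c ->
  circle_interior (act t c) = gact t @` circle_interior c.
Proof.
move=> oc; have oc' := ocircle_act t oc.
have key p : circle_interior (act t c) (gact t p) <-> circle_interior c p.
  have [k k0 e] := ip_act_gact t c p.
  by rewrite !in_interior // e pmulr_rgt0.
rewrite eqEsubset; split=> p; last by case=> q /key + <-.
rewrite -{1}[p](gactK_rev t) => /key h.
by exists (gact (rev t) p); rewrite ?gactK_rev.
Qed.

(** The choice made in [circle_image] is forced, because an oriented circle is determined by its
    interior. *)
Lemma circle_image_gact t c : is_ocircle c -> circle_image (gact t) c = act t c.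
Proof.
move=> oc; apply: xget_unique.
  by split; [exact: ocircle_act|exact: circle_interior_gact].
move=> c' [oc' e]; apply: circle_interior_inj => //; first exact: ocircle_act.
by rewrite e circle_interior_gact.
Qed.

(** This recursion on the first letter underlies all growth estimates: the new term is a multiple of
    the wall [d i] carried along by [t]. *)
Lemma act_cons i t x :
  act (i :: t) x = (- 2 * ip (d i) x) *: act t (d i) + act t x.
Proof.
by rewrite /act /= -/(act t _) /refl actD actN actZ mulNr scaleNr addrC.
Qed.

Lemma act_cons_self (i : 'I_n) t : act (i :: t) (d i) = - act t (d i).
Proof. by rewrite /act /= refl_id ?ip_dual // -/(act t _) actN. Qed.

(* The circles obtained from longer and longer reduced words are nested, and
   their coordinates grow at least as fast as for two tangent circles, whose
   reflections generate a parabolic group. *)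
Lemma growth_step (phi : 'cV[R]_4 -> R) delta : scalar phi -> 0 <= delta ->
  (forall j, 0 <= phi (d j)) ->
  (forall i j, i != j -> delta <= phi (d i) + phi (d j)) ->
  forall t i, reduced (i :: t) -> 0 <= phi (act t (d i)) /\
    forall j, j != i -> phi (act t (d i)) + delta <= phi (act (i :: t) (d j)).
Proof.
move=> lphi delta0 p0 pd.
have phiE t i j : phi (act (i :: t) (d j)) =
    (- 2 * ip (d i) (d j)) * phi (act t (d i)) + phi (act t (d j)).
  by rewrite act_cons lphi.
have phiN x : phi (- x) = - phi x.
  have p00 : phi 0 = 0 by have := lphi 1 0 0; rewrite scaler0 addr0 mul1r; lra.
  by have := lphi (-1) x 0; rewrite addr0 scaleN1r p00; lra.
elim=> [|k t IH] i.
  move=> _; split; first exact: p0.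
  move=> j ji; rewrite phiE /=; have [L _] := dd ji; rewrite ipC in L.
  have := pd _ _ ji; have := p0 i; rewrite /act /= => h.
  have : 0 <= (- 1 - ip (d i) (d j)) * phi (d i) by rewrite mulr_ge0 //; lra.
  lra.
rewrite /reduced /= => /andP[ik rt].
have [pk IHk] := IH _ rt; have ki := IHk _ ik.
have pi0 : 0 <= phi (act (k :: t) (d i)) by lra.
split=> // j ji; rewrite (phiE (k :: t) i j).
have [L _] := dd ji; rewrite ipC in L.
have h : 0 <= (- 1 - ip (d i) (d j)) * phi (act (k :: t) (d i)).
  by rewrite mulr_ge0 //; lra.
have [jk|jk] := eqVneq j k.
  have -> : act (k :: t) (d j) = - act t (d k) by rewrite jk act_cons_self.
  by rewrite phiN; lra.
by have := IHk _ jk; lra.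
Qed.

(** Adjacent letters of a reduced word differ, so [growth_step] gains [delta] at every letter. *)
Lemma growth (phi : 'cV[R]_4 -> R) delta : scalar phi -> 0 <= delta ->
  (forall j, 0 <= phi (d j)) ->
  (forall i j, i != j -> delta <= phi (d i) + phi (d j)) ->
  forall t i, reduced (i :: t) -> delta * (size t)%:R <= phi (act t (d i)).
Proof.
move=> lphi delta0 p0 pd; have G := growth_step lphi delta0 p0 pd.
elim=> [|k t IH] i rt; first by rewrite mulr0; case: (G _ _ rt).
move: rt; rewrite /reduced /= => /andP[ik rt].
have [_ /(_ _ ik)] := G _ _ rt; have := IH _ rt.
by rewrite -[(size t).+1]addn1 natrD; lra.
Qed.

(** The functional - <q, .> is positive on every wall, so [growth] makes it unbounded along long
    words. With at least three walls their sum works: the diagonal term 1 is outweighed by at least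
    two terms that are at most -1. *)
Lemma exists_center : exists q, forall j, ip q (d j) < 0.
Proof.
case: n d od dd dN => [|[|[|m]]] e oe ee eN.
- by exists 0; case.
- exists (- e ord0) => j; rewrite (ord1 j) ipNl.
  by rewrite (proj1 (ocircle_ip _)) // oppr_lt0 ltr01.
(* The sum of the two vectors, which serves for more walls, is null when the
   walls are tangent; so a timelike vector is tilted along their difference. *)
- have e00 := proj1 (ocircle_ip _) (oe ord0).
  have e11 := proj1 (ocircle_ip _) (oe ord_max).
  have [L fu] := ee ord0 ord_max isT.
  have := future_neq0 fu (eN ord0 ord_max isT); rewrite !coordE => F.
  set X := cocurv (e ord0) + curv (e ord0); set Y := cocurv (e ord_max) + curv (e ord_max).
  have XY : 0 < X + Y by rewrite /X /Y; lra.
  have ipf (v : 'cV[R]_4) : ip (vec4 1 1 0 0) v = - (cocurv v + curv v) / 2.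
    by rewrite /ip !coordE; field.
  have L1 : 1 - ip (e ord0) (e ord_max) != 0 by apply: lt0r_neq0; lra.
  (* This value makes both pairings equal to -(X + Y) / 4. *)
  set t := (Y - X) / 4 / (1 - ip (e ord0) (e ord_max)).
  have tL : t * (1 - ip (e ord0) (e ord_max)) = (Y - X) / 4 by rewrite divfK.
  exists (vec4 1 1 0 0 - t *: (e ord0 - e ord_max)).
  have key (j : 'I_2) : j = ord0 \/ j = ord_max.
    by case: j => [[|[|//]]] p; [left|right]; apply: val_inj.
  move=> j; case: (key j) => ->; rewrite !ipE ipf.
    by rewrite e00 (ipC (e ord_max)) -/X; lra.
  by rewrite e11 -/Y; lra.
- exists (\sum_j e j) => l.
  have ip_sum (r : seq 'I_m.+3) (P : pred 'I_m.+3) :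
      ip (\sum_(j <- r | P j) e j) (e l) = \sum_(j <- r | P j) ip (e j) (e l).
    elim/big_ind2: _ => [|x a y b <- <-|//]; first by rewrite ipC ip0r.
    by rewrite ipDl.
  rewrite ip_sum (bigD1 l) //= (proj1 (ocircle_ip _)) //.
  have : \sum_(j | j != l) ip (e j) (e l) <= \sum_(j | j != l) -1.
    by apply: ler_sum => j jl; case: (ee _ _ jl).
  rewrite sumr_const cardC1 card_ord /= mulNrn.
  have : 2 <= m.+2%:R :> R by rewrite ler_nat.
  by lra.
Qed.

(** The normal at [z] is a unit vector, which bounds [h1] and [h2] by 1 + T M; the equation of the
    circle at [z] then bounds [cocurv]. *)
Lemma circle_bound (q : 'cV[R]_4) (T M : R) : 0 <= T -> 0 <= M ->
  exists K, forall D (z : R[i]), is_ocircle D -> `|curv D| <= T ->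
    circle D (Some z) -> `|z| <= M%:C -> - ip q D <= K.
Proof.
move=> T0 M0; set H := 1 + T * M; set Co := 4 * (H * M) + T * M ^+ 2.
have H0 : 0 <= H by rewrite addr_ge0 ?mulr_ge0.
exists ((`|h1 q| + `|h2 q|) * H + (`|cocurv q| * T + `|curv q| * Co) / 2).
move=> D z oD bD; rewrite in_circle // ip_nul_Some sqr_norm_le // => zD zM.
rewrite ocircle_ip /ip in oD; move: zD zM.
set a := complex.Re z; set b := complex.Im z => zD zM.
have E : (curv D * a - h1 D) ^+ 2 + (curv D * b - h2 D) ^+ 2 = 1.
  move: oD; have -> : cocurv D = 2 * (h1 D * a + h2 D * b) - curv D * (a ^+ 2 + b ^+ 2) by lra.
  by move=> <-; field.
have sq (x k : R) : 0 <= k -> x ^+ 2 <= k ^+ 2 -> `|x| <= k.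
  by move=> k0; rewrite -[x ^+ 2]real_normK ?num_real // ler_sqr ?nnegrE.
have aM : `|a| <= M by apply: sq => //; have := sqr_ge0 b; lra.
have bM : `|b| <= M by apply: sq => //; have := sqr_ge0 a; lra.
have hH (x y : R) : `|x| <= M -> (curv D * x - y) ^+ 2 <= 1 -> `|y| <= H.
  move=> xM; rewrite -[leRHS](expr1n _ 2) => /(sq _ _ ler01) h.
  have -> : y = - (curv D * x - y) + curv D * x by ring.
  apply: le_trans (ler_normD _ _) _; rewrite normrN normrM lerD //.
  exact: ler_pM.
have H1 : `|h1 D| <= H.
  by apply: (hH a) => //; have := sqr_ge0 (curv D * b - h2 D); lra.
have H2 : `|h2 D| <= H.
  by apply: (hH b) => //; have := sqr_ge0 (curv D * a - h1 D); lra.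
have CoD : `|cocurv D| <= Co.
  have -> : cocurv D = 2 * (h1 D * a) + 2 * (h2 D * b) - curv D * (a ^+ 2 + b ^+ 2) by lra.
  apply: le_trans (ler_normB _ _) _; rewrite /Co lerD //; last first.
    rewrite normrM ler_pM // ger0_norm // addr_ge0 ?sqr_ge0 //.
  apply: le_trans (ler_normD _ _) _; rewrite !normrM (ger0_norm (ler0n R 2)).
  have := ler_pM (normr_ge0 _) (normr_ge0 _) H1 aM.
  have := ler_pM (normr_ge0 _) (normr_ge0 _) H2 bM.
  lra.
apply: le_trans (ler_norm _) _; rewrite normrN /ip.
apply: le_trans (ler_normB _ _) _; apply: lerD.
  apply: le_trans (ler_normD _ _) _; rewrite !normrM mulrDl.
  by apply: lerD; apply: ler_wpM2l.
rewrite normrM (ger0_norm (_ : 0 <= 2^-1)) ?invr_ge0 //.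
apply: ler_wpM2r; first by rewrite invr_ge0.
apply: le_trans (ler_normD _ _) _; rewrite !normrM.
by apply: lerD; apply: ler_wpM2l.
Qed.

(* If infinity stayed outside all translates of the chamber, it would lie in an
   infinite nested sequence of dual discs, whose circles all meet the disc
   |z| <= M: these circles would remain bounded, contradicting their growth. *)
Lemma exists_chamber (M : R) : 0 <= M ->
  (forall t j, exists2 z : R[i], circle (act t (d j)) (Some z) & `|z| <= M%:C) ->
  exists s, forall j, 0 <= curv (act s (d j)).
Proof.
move=> M0 meet; apply: contrapT => /forallNP no.
have {}no s : exists j, curv (act s (d j)) < 0.
  by have /existsNP[j /negP] := no s; rewrite -ltNge => ?; exists j.
have [j0 c0] := no [::]; set T := - curv (act [::] (d j0)).
have T0 : 0 <= T by rewrite oppr_ge0 ltW.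
have long k : exists s i, [/\ size s = k, reduced (i :: s),
    - T <= curv (act s (d i)) & curv (act s (d i)) < 0].
  elim: k => [|k [s [i [sk ri lo up]]]].
    by exists [::], j0; split; rewrite // /T opprK.
  have [j cj] := no (i :: s); exists (i :: s), j.
  have ji : j != i.
    by apply/eqP => ji; move: cj; rewrite ji act_cons_self coordE; lra.
  split; rewrite /= ?sk //; first by rewrite /reduced /= ji.
  apply: le_trans lo _.
  (* The sum of two walls stays in the cone and the letter [i] reverses its own wall, so the
     curvature of the new wall is at least that of the previous one. *)
  have [_ /(future_act (i :: s))] := dd ji.
  by rewrite actD act_cons_self => -[_ + _]; rewrite !coordE; lra.
have [q qd] := exists_center.
have [|delta delta0 qdelta] := @positive_lower_bound R _ (fun j => - ip q (d j)).
  by move=> j; rewrite oppr_gt0.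
have [K bK] := circle_bound q T0 M0.
have [k Kk] : exists k : nat, K < delta * k%:R.
  exists (Num.bound `|K / delta|); rewrite mulrC -ltr_pdivrMr //.
  apply: le_lt_trans (ler_norm _) _; exact/archi_boundP.
have [s [i [sk ri lo up]]] := long k.
have [z zs zM] := meet s i.
have := bK _ _ (ocircle_act s (od i)) _ zs zM.
have -> : `|curv (act s (d i))| <= T by rewrite ltr0_norm // lerNl.
move/(_ isT); apply/negP; rewrite -ltNge; apply: lt_le_trans Kk _; rewrite -sk.
apply: (@growth (fun x => - ip q x)) => //.
- by move=> a x y; rewrite !ipE mulrN opprD.
- exact: ltW.
- by move=> j; have := qdelta j; lra.
- by move=> j l _; have := qdelta j; have := qdelta l; lra.
Qed.

(** Two walls of curvature 0 have a sum of curvature 0 in the cone, which must be a nonzero multiple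
    of the null vector of infinity. The walls are then tangent at infinity, and a circle orthogonal
    to both passes through infinity, against [touch]. *)
Lemma chamber_one_wall s :
  (forall j l, j != l -> ip (d j) (d l) = -1 ->
    exists c, [/\ ip c (d j) = 0, ip c (d l) = 0 & curv (act s c) <> 0]) ->
  forall j l, j != l -> curv (act s (d j)) = 0 -> curv (act s (d l)) = 0 -> False.
Proof.
move=> touch j l jl cj cl; have [L fu] := dd jl.
set u := act s (d j + d l).
have u1 : curv u = 0 by rewrite /u actD !coordE cj cl addr0.
have [u0 _ uu] := future_act s fu; rewrite -/u in u0 uu.
have uuE : ip u u = 2 + 2 * ip (d j) (d l).
  by rewrite ip_act !ipE !ip_dual (ipC (d l)); lra.
have hu : h1 u ^+ 2 + h2 u ^+ 2 = ip u u by rewrite /ip u1; ring.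
have := sqr_ge0 (h1 u); have := sqr_ge0 (h2 u) => s2 s1.
have [c [cj0 cl0]] : exists c, [/\ ip c (d j) = 0, ip c (d l) = 0 & curv (act s c) <> 0].
  by apply: touch => //; lra.
apply; have : ip (act s c) u = 0 by rewrite ip_act ipDr cj0 cl0 addr0.
have z1 : h1 u = 0 by apply/eqP; rewrite -sqrf_eq0; apply/eqP; lra.
have z2 : h2 u = 0 by apply/eqP; rewrite -sqrf_eq0; apply/eqP; lra.
rewrite /ip u1 z1 z2 !mulr0 !add0r => /eqP; rewrite oppr_eq0 mulf_eq0 invr_eq0.
rewrite (@pnatr_eq0 _ 2) orbF mulf_eq0 => /orP[/eqP //|/eqP u00].
case: (dN jl); rewrite -(act_revK s (d j + d l)) -/u (_ : u = 0) ?act0 //.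
by apply: future_anti; rewrite /future ?coordE ?u00 ?u1 ?oppr0 ?ipNl
  ?ipNr ?opprK; split => //; lra.
Qed.

End DualGroup.

Arguments act : simpl never.

(** * Summability, counting of words and minima *)

Section Summability.
Variable R : realType.

(** At most n^k distinct words have length k, so level k contributes at most (1/2)^k; [below]
    compares with the partial sums of the geometric series. *)
Lemma sum_uniq_words (n : nat) (rho : R) (X : seq (seq 'I_n)) :
  0 <= rho -> n%:R * rho <= 1 / 2 -> uniq X ->
  \sum_(s <- X) rho ^+ size s <= 2.
Proof.
move=> r0 nr uX.
have level k : \sum_(s <- X | size s == k) rho ^+ size s <= (1 / 2) ^+ k.
  apply: (@le_trans _ _ ((n%:R * rho) ^+ k)); last first.
    by rewrite lerXn2r ?nnegrE ?mulr_ge0.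
  rewrite (eq_bigr (fun=> rho ^+ k)) => [|s /eqP -> //].
  rewrite big_const_seq iter_addr_0 exprMn -[X in X <= _]mulr_natl.
  apply: ler_wpM2r; first exact: exprn_ge0.
  rewrite -natrX ler_nat -size_filter.
  have := @uniq_leq_size _ [seq s <- X | size s == k] (map val (enum {: k.-tuple 'I_n})).
  rewrite filter_uniq // size_map -cardE card_tuple card_ord; apply=> // s.
  rewrite mem_filter => /andP[sk _]; apply/mapP; exists (Tuple sk) => //.
  by rewrite mem_enum.
have below N : \sum_(s <- X | (size s < N)%N) rho ^+ size s <= 2 - 2 * (1 / 2) ^+ N.
  elim: N => [|N IH]; first by rewrite big_pred0 // expr0; lra.
  rewrite (bigID (fun s => size s == N)) /=.
  rewrite (eq_bigl (fun s => size s == N)); last first.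
    by move=> s; rewrite ltnS; case: eqP => [->|]; rewrite ?leqnn ?andbF.
  rewrite [X in _ + X](eq_bigl (fun s => (size s < N)%N)); last first.
    by move=> s; rewrite ltnS ltn_neqAle andbC.
  by rewrite exprS; have := level N; lra.
apply: (@le_trans _ _ (2 - 2 * (1 / 2) ^+ (\max_(s <- X) size s)%N.+1)); last first.
  by rewrite gerBl mulr_ge0 // exprn_ge0 // divr_ge0.
apply: le_trans (below _); rewrite big_seq_cond [leRHS]big_seq_cond.
rewrite le_eqVlt; apply/orP; left; apply/eqP; apply: eq_bigl => s.
rewrite andbT ltnS; case: (boolP (s \in X)) => //= sX.
by rewrite leq_bigmax_seq.
Qed.

(** Injectivity of [r] turns every finite partial sum into a sum over distinct words. *)
Lemma summable_words (T : choiceType) (D : set T) (n : nat) (f : T -> R)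
    (r : T -> seq 'I_n) (rho K : R) :
  0 <= rho -> n%:R * rho <= 1 / 2 -> 0 <= K -> set_inj D r ->
  (forall x, D x -> `|f x| <= K * rho ^+ size (r x)) ->
  summable D (fun x => (f x)%:E).
Proof.
move=> r0 nr K0 rI fr; rewrite /summable.
apply: (@le_lt_trans _ _ (K * 2)%:E); last exact: ltry.
apply: ge_ereal_sup => _ [A [finA AD] <-].
rewrite fsbig_finite //= sumEFin lee_fin.
apply: (@le_trans _ _ (\sum_(x <- fset_set A) K * rho ^+ size (r x))).
  rewrite big_seq [leRHS]big_seq; apply: ler_sum => x.
  by rewrite in_fset_set // inE => /AD; exact: fr.
rewrite -mulr_sumr; apply: ler_wpM2l => //.
rewrite -(big_map r xpredT (fun s => rho ^+ size s)).
apply: sum_uniq_words => //; rewrite map_inj_in_uniq ?fset_uniq // => x y.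
by rewrite !in_fset_set // !inE => /AD Dx /AD Dy; apply: rI; rewrite inE.
Qed.

(** Infinitely many terms that are at least [e] would make the partial sums unbounded. *)
Lemma summable_finite_superlevel (T : choiceType) (D : set T) (f : T -> R) (e : R) :
  0 < e -> summable D (fun x => (f x)%:E) -> finite_set [set x | D x /\ e <= f x].
Proof.
move=> e0 Ds; apply: contrapT => inf.
move: Ds; rewrite summableE => /fineK; set S := fine _ => SE.
have [m Sm] : exists m : nat, S < m%:R * e.
  exists (Num.bound `|S / e|); rewrite -ltr_pdivrMr //.
  by apply: le_lt_trans (ler_norm _) _; exact/archi_boundP.
have [B BA Bm] := infinite_set_fset m inf.
have : ((m%:R * e)%:E <= \esum_(x in D) `|(f x)%:E|)%E.
  apply: esum_ge; exists [set` B]; first by split=> // x /BA[].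
  rewrite fsbig_finite // set_fsetK /= sumEFin lee_fin.
  apply: (@le_trans _ _ (\sum_(x <- B) e)).
    rewrite big_const_seq iter_addr_0 count_predT -[leRHS]mulr_natl.
    by apply: ler_wpM2r; [exact: ltW|rewrite ler_nat].
  rewrite big_seq [leRHS]big_seq; apply: ler_sum => x xB.
  have [_ fx] : [set x | D x /\ e <= f x] x by exact: BA.
  exact: le_trans fx (ler_norm _).
by rewrite -SE lee_fin leNgt Sm.
Qed.

Lemma exists_minimum (T : choiceType) (A : set T) (f : T -> R) :
  finite_set A -> A !=set0 -> exists2 x, A x & forall y, A y -> f x <= f y.
Proof.
move=> finA [a Aa].
have [s sA] : exists s : seq T, A = [set x | x \in s].
  by exists (fset_set A); apply/seteqP; split=> x /=; rewrite in_fset_set // inE.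
rewrite sA /= in Aa *; elim: s a Aa {sA} => // b s IH a _.
case: s IH => [|c s] IH.
  by exists b; rewrite /= ?mem_head // => y; rewrite inE => /eqP ->.
have [x xs xm] := IH c (mem_head _ _).
have [bx|xb] := leP (f b) (f x).
  exists b; rewrite /= ?mem_head // => y; rewrite inE => /orP[/eqP -> //|/xm].
  exact: le_trans.
exists x; first by rewrite /= inE xs orbT.
by move=> y; rewrite inE => /orP[/eqP ->|/xm //]; exact: ltW.
Qed.

End Summability.

(** * Convergence of the sum and the orbit of the closed chamber *)

Section Convergence.
Variables (R : realType) (n : nat) (d : 'I_n -> 'cV[R]_4).
Hypothesis od : forall j, is_ocircle (d j).
Hypothesis dd : forall j l, j != l -> ip (d j) (d l) <= -1 /\ future (d j + d l).
Implicit Types (t s : seq 'I_n) (i j l : 'I_n) (x y z c : 'cV[R]_4).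
Local Notation act := (act d).
Local Notation gact := (gact d).

Variable s0 : seq 'I_n.
Local Notation phi := (fun v => curv (act s0 v)).
Hypothesis chamber : forall j, 0 <= phi (d j).
Hypothesis one_wall : forall j l, j != l -> phi (d j) = 0 -> phi (d l) = 0 -> False.

(* A_0 in the coordinates y = C s. *)
Definition in_A0 y : Prop := (forall j, 0 <= - ip (d j) y) /\
  (forall j l, - ip (d j) y = 0 -> - ip (d l) y = 0 -> j = l).

Lemma phi_scalar : scalar phi.
Proof. by move=> a x y; rewrite actD actZ !coordE. Qed.

(** A letter [i] in front adds 2 (- <d_i, y>) times the curvature of a wall, which grows linearly
    with the length. A single letter may add nothing when [y] lies on its wall, but two consecutive
    letters differ and cannot both add nothing. *)
Lemma quadratic_growth y : in_A0 y -> exists2 e, 0 < e & forall t, reduced t ->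
  phi y + e * ((size t)%:R * ((size t)%:R - 2)) <= phi (act t y).
Proof.
move=> [a0 a1].
have [delta delta0 pd] := pair_lower_bound chamber one_wall.
have [|alpha alpha0 ad] := pair_lower_bound a0.
  by move=> j l /negP jl aj al; apply: jl; rewrite (a1 _ _ aj al).
have G := growth od dd phi_scalar (ltW delta0) chamber pd.
exists (alpha * delta / 2); first by rewrite divr_gt0 // mulr_gt0.
move=> t.
set e := alpha * delta / 2.
have phi_cons i s : phi (act (i :: s) y) =
    2 * (- ip (d i) y * phi (act s (d i))) + phi (act s y).
  by rewrite /= act_cons phi_scalar; ring.
pose Q s := phi y + e * ((size s)%:R * ((size s)%:R - 2)) <= phi (act s y).
suff : (reduced t -> Q t) /\ (forall i, reduced (i :: t) -> Q (i :: t)) by case.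
have Gpos i s : reduced (i :: s) -> 0 <= phi (act s (d i)).
  by move=> /G; apply: le_trans; rewrite mulr_ge0 // ltW.
have e0 : 0 < e by rewrite divr_gt0 // mulr_gt0.
(* The induction advances by two letters, with (k + 2) k - k (k - 2) = 4 k. At lengths 0 and 1 the
   quadratic term is at most 0, so it is enough that the curvature does not decrease. *)
elim: t => [|j t [IH1 IH2]]; split.
- by move=> _; rewrite /Q mul0r mulr0 addr0.
- move=> i ri; rewrite /Q phi_cons /= mul1r.
  have := mulr_ge0 (a0 i) (Gpos _ _ ri); rewrite /act /=; lra.
- exact: IH2.
- move=> i; rewrite {1}/reduced /= => /andP[ij rt].
  have rij : reduced (i :: j :: t) by rewrite /reduced /= ij.
  have {IH1 IH2} := IH1 (path_sorted rt); rewrite /Q !phi_cons.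
  set k : R := (size t)%:R.
  have -> : (size (i :: j :: t))%:R = k + 2 :> R.
    by rewrite /= -addn2 natrD.
  have k0 : 0 <= k by exact: ler0n.
  have gi : delta * k <= phi (act (j :: t) (d i)).
    apply: le_trans (G _ _ rij); apply: ler_wpM2l; first exact: ltW.
    by rewrite ler_nat.
  have gj : delta * k <= phi (act t (d j)) := G _ _ rt.
  have := ler_wpM2l (a0 i) gi; have := ler_wpM2l (a0 j) gj => Hj Hi.
  have := ler_wpM2r (mulr_ge0 (ltW delta0) k0) (ad _ _ ij).
  rewrite {1 2}/e; lra.
Qed.

Variables (D : set (Chat R -> Chat R)) (F : (Chat R -> Chat R) -> R) (y : 'cV[R]_4).
Hypothesis DP : forall g, D g <-> exists t, g = gact t.
Hypothesis FE : forall t, F (gact t) = curv (act t y).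

Lemma converges_of_A0 u z : y = act u z -> in_A0 z ->
  summable D (fun g => (expR (- F g))%:E).
Proof.
move=> yE /quadratic_growth[e e0 growth_z].
(* With this word, the term of [g] is governed by [phi (act (r g) z)]: [rev u] brings [y] back to
   [z], and [s0] is the shift contained in [phi]. *)
have /choice[r rP] : forall g, exists r, D g ->
    reduced r /\ g = gact (rev u ++ r ++ s0).
  move=> g; have [/DP[t ->]|nD] := pselect (D g); last by exists [::].
  have [r rr re] := gact_reduced od (u ++ t ++ rev s0).
  exists r => _; split=> //; rewrite !gact_cat re !gact_cat.
  by apply: funext => p /=; rewrite !gactK_rev.
(* The ratio exp(-L) = 1 / (2 (n + 1)) satisfies the smallness condition of [summable_words], also
   for n = 0. *)
pose L : R := ln (2 * (n.+1)%:R).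
have n0 : 0 < 2 * (n.+1)%:R :> R by rewrite mulr_gt0.
have LE : expR L = 2 * (n.+1)%:R by rewrite lnK // posrE.
(* The constant that completes e k (k - 2) - L k to a square. *)
pose A : R := (2 * e + L) ^+ 2 / (4 * e).
apply: (@summable_words _ _ D n _ r (expR (- L)) (expR (A - phi z))).
- exact: expR_ge0.
- rewrite expRN LE ler_pdivrMr //.
  have : n%:R <= (n.+1)%:R :> R by rewrite ler_nat.
  by lra.
- exact: expR_ge0.
- move=> g g'; rewrite !inE => /rP[_ gE] /rP[_ gE'] rg.
  by rewrite gE gE' rg.
move=> g Dg; have [rr gE] := rP g Dg.
rewrite ger0_norm ?expR_ge0 // {1}gE FE yE !act_cat act_revK //.
rewrite -expRM_natr -expRD ler_expR.
set k : R := (size (r g))%:R.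
have := growth_z _ rr; rewrite -/k => gz.
suff : L * k - A <= e * (k * (k - 2)) by lra.
rewrite -subr_ge0 (_ : _ - _ = (2 * e * k - (2 * e + L)) ^+ 2 / (4 * e)).
  by rewrite divr_ge0 ?sqr_ge0 // mulr_ge0 // ltW.
by rewrite /A; field; exact: lt0r_neq0.
Qed.

(* The word (j l)^k, written so that consing a letter makes it act first. *)
Definition dihedral_word j l k : seq 'I_n := iter k (fun t => j :: l :: t) [::].

Lemma dihedral_word_reduced j l k : j != l -> reduced (l :: dihedral_word j l k).
Proof.
move=> jl; rewrite /reduced; elim: k => //= k IH.
by rewrite eq_sym jl /= IH.
Qed.

(** The transformations are told apart by the image of the circle [d l], whose curvature after [s0]
    grows by at least 2 [delta] with each pair of letters. *)
Lemma dihedral_word_inj j l : j != l -> injective (fun k => gact (dihedral_word j l k)).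
Proof.
move=> jl k k' /= /(congr1 (fun g => curv (act s0 (circle_image g (d l))))).
rewrite !circle_image_gact //.
have [delta delta0 pd] := pair_lower_bound chamber one_wall.
have G := growth_step od dd phi_scalar (ltW delta0) chamber pd.
have lj : l != j by rewrite eq_sym.
have step m : phi (act (dihedral_word j l m) (d l)) <
    phi (act (dihedral_word j l m.+1) (d l)).
  have rl := dihedral_word_reduced m jl.
  have [_ /(_ _ jl) h] := G _ _ rl.
  have [|_ /(_ _ lj) h'] := G (l :: dihedral_word j l m) j.
    by rewrite /reduced /= jl.
  by rewrite /= in h h' *; lra.
have mono := homo_ltn lt_trans step.
by case: (ltngtP k k') => // /mono /= + e; rewrite e ltxx.
Qed.

(** Convergence makes the sublevel sets of [F] finite, so [F] has a minimum. A wall of positive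
    curvature on the wrong side of the minimizer would allow a reflection that lowers the value; an
    infinite stabilizer would contradict finiteness. *)
Lemma A0_of_converges : summable D (fun g => (expR (- F g))%:E) ->
  exists u z, y = act u z /\ in_A0 z.
Proof.
move=> cv.
have fin K : finite_set [set g | D g /\ F g <= K].
  have := summable_finite_superlevel (expR_gt0 (- K)) cv.
  by apply: sub_finite_set => g [Dg FK]; split=> //; rewrite ler_expR lerN2.
have D1 : D (gact [::]) by apply/DP; exists [::].
have [g0 [Dg0 Fg0] minF'] := exists_minimum F (fin (F (gact [::])))
  (ex_intro _ _ (conj D1 (lexx _))).
have minF g : D g -> F g0 <= F g.
  move=> Dg; have [h|h] := leP (F g) (F (gact [::])); first exact: minF'.
  exact: le_trans Fg0 (ltW h).
have [t0 g0E] := proj1 (DP g0) Dg0.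
have minimal u z : y = act u z -> phi z = F g0 -> forall w, phi z <= phi (act w z).
  move=> yE -> w; have := minF (gact (rev u ++ w ++ s0)).
  by rewrite FE !act_cat yE act_revK //; apply; apply/DP; eexists.
have wall_le u z j : y = act u z -> phi z = F g0 -> 0 < phi (d j) -> ip (d j) z <= 0.
  move=> yE zF pj; have := minimal u z yE zF [:: j].
  rewrite act_cons phi_scalar /= -[X in X <= _]add0r lerD2r !mulNr oppr_ge0.
  by rewrite pmulr_lle0 // pmulr_rle0.
have [u [z [yE zF zle]]] : exists u z,
    [/\ y = act u z, phi z = F g0 & forall j, ip (d j) z <= 0].
  pose y0 := act (rev s0) (act t0 y).
  have yE0 : y = act (s0 ++ rev t0) y0 by rewrite act_cat actK_rev // act_revK.
  have yF0 : phi y0 = F g0 by rewrite /y0 actK_rev // g0E FE.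
  have [all_le|] := pselect (forall j, ip (d j) y0 <= 0).
    by exists (s0 ++ rev t0), y0.
  move=> /existsNP[j /negP]; rewrite -ltNge => jpos.
  have pj : phi (d j) = 0.
    apply/eqP; rewrite eq_le chamber andbT leNgt; apply/negP => /(wall_le _ _ _ yE0 yF0).
    by rewrite leNgt jpos.
  (* Reflecting in the one wall with [phi (d j) = 0] keeps the value minimal and changes the sign of
     the pairing with [d j]. All other walls have positive [phi], so [wall_le] applies to them. *)
  pose z := act [:: j] y0.
  have zE : y = act (j :: s0 ++ rev t0) z.
    rewrite -cat1s act_cat {1}yE0 /z; congr (act _ _).
    by rewrite -{1}(actK_rev od [:: j] y0).
  have zF : phi z = F g0.
    by rewrite /z act_cons phi_scalar /= pj mulr0 add0r yF0.
  exists (j :: s0 ++ rev t0), z; split=> // l.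
  have [->|lj] := eqVneq l j.
    rewrite /z /act /= /refl !ipE ip_dual //; lra.
  apply: (wall_le _ _ _ zE zF); rewrite lt_neqAle chamber andbT eq_sym.
  by apply/eqP => pl; exact: one_wall lj pl pj.
exists u, z; split=> //; split=> [j|j l zj zl]; first by rewrite oppr_ge0.
(* A point on two walls is fixed by all powers of the product of their reflections; these would give
   infinitely many elements at which [F] is minimal. *)
apply/eqP; apply: contrapT => /negP jl; apply: infinite_nat.
have fixz k : act (dihedral_word j l k) z = z.
  elim: k => //= k IH; rewrite !act_cons.
  have -> : ip (d j) z = 0 by lra.
  have -> : ip (d l) z = 0 by lra.
  by rewrite mulr0 !scale0r !add0r.
pose h k := gact (rev u ++ dihedral_word j l k ++ s0).
have hI : injective h.
  have hE k : gact (dihedral_word j l k) = gact (rev s0) \o h k \o gact u.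
    apply: funext => p; rewrite /h !gact_cat /=.
    by rewrite !gact_revK.
  by move=> k k' e; apply: (dihedral_word_inj jl); rewrite /= !hE e.
have -> : [set: nat] = h @^-1` [set g | D g /\ F g <= F g0].
  apply/seteqP; split=> // k _; split; first by apply/DP; eexists.
  by rewrite /h FE !act_cat yE act_revK // fixz zF.
by apply: finite_preimage => // k k' _ _; exact: hI.
Qed.

End Convergence.

(** * Coordinates on the dual space *)

Section DualSpace.
Variables (R : realType) (m : nat) (C : 'M[R]_(4, m)).
Local Open Scope quotient_scope.

Definition dual_coord (s : Vdual C) : 'cV[R]_4 := C *m repr s.

Lemma pairing_dual_coord (x : 'cV[R]_4) (s : Vdual C) :
  pairing (C^T *m x) s = (x^T *m dual_coord s) 0 0.
Proof. by rewrite /pairing /dotv trmx_mul trmxK -mulmxA. Qed.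

Lemma dual_coord_inj : injective dual_coord.
Proof.
move=> s t e; rewrite -[s]reprK -[t]reprK; apply/eqmodP.
by rewrite /= /ker_eq mulmxBr subr_eq0; apply/eqP.
Qed.

(** The right inverse of [C] makes [dual_coord] surjective. *)
Lemma dual_coord_pi (Ct : 'M[R]_(m, 4)) (y : 'cV[R]_4) : C *m Ct = 1%:M ->
  dual_coord (\pi_(Vdual C) (Ct *m y)) = y.
Proof.
move=> CCt; rewrite /dual_coord.
have /eqmodP : repr (\pi_(Vdual C) (Ct *m y)) = Ct *m y %[mod_eq ker_equiv C].
  by rewrite reprK.
by rewrite /= /ker_eq mulmxBr subr_eq0 => /eqP ->; rewrite mulmxA CCt mul1mx.
Qed.

End DualSpace.

(** * Simple roots and the group W in coordinates *)

Section Roots.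
Variables (R : realType) (m n : nat) (c : 'I_m -> 'cV[R]_4) (d : 'I_n -> 'cV[R]_4).
Variable Ct : 'M[R]_(m, 4).
Hypothesis od : forall j, is_ocircle (d j).
Hypothesis CCt : circle_mx c *m Ct = 1%:M.
Local Notation C := (circle_mx c).

Lemma Pmx_ip (x y : 'cV[R]_4) : ((Pmx R *m x)^T *m y) 0 0 = ip x y.
Proof.
rewrite mxE sum4 !mxE !sum4 !mxE /= !inordK //=.
by rewrite /ip /cocurv /curv /h1 /h2; field.
Qed.

Lemma Pmx_tr : (Pmx R)^T = Pmx R.
Proof.
by apply/matrixP => -[[|[|[|[|//]]]] i] [[|[|[|[|//]]]] j]; rewrite !mxE.
Qed.

Lemma Pmx_unit : Pmx R \in unitmx.
Proof.
pose Q : 'M[R]_4 := \matrix_(i, j) (nth [::] [:: [:: 0; -2; 0; 0];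
  [:: -2; 0; 0; 0]; [:: 0; 0; 1; 0]; [:: 0; 0; 0; 1]] i)`_j.
suff /mulmx1_unit[] : Pmx R *m Q = 1%:M by [].
apply/matrixP => i j; rewrite mxE sum4 !mxE -val_eqE /= !inordK //=.
by case: i j => -[|[|[|[|//]]]] i [[|[|[|[|//]]]] j]; rewrite /=; field.
Qed.

Lemma dotv_alpha j (r : 'cV[R]_m) : dotv (alpha c d j) r = - ip (d j) (C *m r).
Proof.
rewrite /dotv /alpha linearN /= mulNmx mxE -Pmx_ip -mulmxA.
by rewrite trmx_mul trmxK -mulmxA.
Qed.

Lemma pairing_alpha j (s : Vdual C) : pairing (alpha c d j) s = - ip (d j) (dual_coord s).
Proof. exact: dotv_alpha. Qed.

(** In the coordinate [x] of V, [sigma] is the transpose of the reflection in [d j]. *)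
Lemma sigmaE j (x : 'cV[R]_4) : sigma c d Ct j (C^T *m x) =
  C^T *m (x - (2 * ((d j)^T *m x) 0 0) *: (Pmx R *m d j)).
Proof.
rewrite /sigma dotv_alpha.
have CG : C *m (Gtilde Ct *m (C^T *m x)) = invmx (Pmx R) *m x.
  rewrite /Gtilde !mulmxA CCt mul1mx -!mulmxA; congr (_ *m _).
  by rewrite !mulmxA -trmx_mul CCt trmx1 mul1mx.
rewrite CG -Pmx_ip trmx_mul Pmx_tr -!mulmxA (mulmxA (Pmx R)) mulmxV ?Pmx_unit // mul1mx.
by rewrite /alpha mulmxBr -scalemxAr mulrN scaleNr scalerN opprK mulmxA.
Qed.

(** The root [alpha] has norm 1 for [Gtilde], because [d j] has norm 1; the identity therefore holds
    on all of R^m, as [generated_groupP] demands. *)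
Lemma sigmaK j : involutive (sigma c d Ct j).
Proof.
move=> b; rewrite /sigma; set k := 2 * dotv _ (_ *m b).
have aa : dotv (alpha c d j) (Gtilde Ct *m alpha c d j) = 1.
  rewrite dotv_alpha /alpha mulmxN mulmxN ipNr opprK /Gtilde !mulmxA CCt mul1mx.
  rewrite -[_ *m Ct^T *m C^T]mulmxA -trmx_mul CCt trmx1 mulmx1 mulVmx ?Pmx_unit //.
  by rewrite mul1mx -ocircle_ip.
have dB (a b' : 'cV[R]_m) q : dotv a (Gtilde Ct *m (b - q *: b')) =
    dotv a (Gtilde Ct *m b) - q * dotv a (Gtilde Ct *m b').
  by rewrite /dotv mulmxBr mulmxBr -!scalemxAr !mxE.
rewrite dB aa mulr1 mulrBr -/k -addrA -opprD -scalerDl.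
by rewrite [X in X *: _](_ : _ = 0) ?scale0r ?subr0 //; ring.
Qed.

(** Transposition reverses the order of the letters, whence [rev t]. *)
Lemma wmap_sigma t (x y : 'cV[R]_4) : exists x', [/\
  wmap (sigma c d Ct) t (C^T *m x) = C^T *m x' &
  (x'^T *m y) 0 0 = (x^T *m act d (rev t) y) 0 0].
Proof.
elim: t x => [|j t IH] x; first by exists x.
have [x' [e1 e2]] := IH (x - (2 * ((d j)^T *m x) 0 0) *: (Pmx R *m d j)).
exists x'; split; first by rewrite /= sigmaE.
rewrite e2 rev_cons -cats1 act_cat; set z := act d (rev t) y.
have mxB (A B : 'M[R]_1) k : (A - k *: B) 0 0 = A 0 0 - k * B 0 0 by rewrite !mxE.
have -> : ((d j)^T *m x) 0 0 = (x^T *m d j) 0 0.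
  by rewrite -[in LHS](trmxK x) -trmx_mul mxE.
rewrite [act d [:: j] z]/(refl (d j) z) /refl linearB linearZ /= mulmxBl -scalemxAl.
by rewrite mulmxBr -scalemxAr !mxB Pmx_ip; ring.
Qed.

Lemma dual_coord_dual_map t (s : Vdual C) :
  dual_coord (dual_map (wmap (sigma c d Ct) t) s) = act d (rev t) (dual_coord s).
Proof.
pose s' : Vdual C := (\pi_(Vdual C) (Ct *m act d (rev t) (dual_coord s)))%qT.
have s'E : dual_coord s' = act d (rev t) (dual_coord s) by exact: dual_coord_pi.
rewrite (_ : dual_map _ s = s') //; apply: xget_unique => [b [x _ <-]|r rP].
  have [x' [-> e]] := wmap_sigma t x (dual_coord s).
  by rewrite !pairing_dual_coord e s'E.
apply: dual_coord_inj; rewrite s'E.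
apply/colP => i.
have := rP (C^T *m delta_mx i 0); have [x' [-> e]] := wmap_sigma t (delta_mx i 0) (dual_coord s).
rewrite !pairing_dual_coord e => /(_ (ex_intro2 _ _ _ I erefl)).
by rewrite trmx_delta -!rowE !mxE => ->.
Qed.

Lemma bigcup_dual_map (s : Vdual C) :
  (\bigcup_(w in Wgroup c d Ct) (dual_map w @` A0 c d)) s <->
  exists u z, dual_coord s = act d u z /\ in_A0 d z.
Proof.
have A0P (r : Vdual C) : A0 c d r <-> in_A0 d (dual_coord r).
  split=> -[a0 a1]; split=> [j|j l].
  - by rewrite -pairing_alpha; exact: a0.
  - by rewrite -!pairing_alpha; exact: a1.
  - by rewrite pairing_alpha; exact: a0.
  - by rewrite !pairing_alpha; exact: a1.
split=> [[w /(generated_groupP sigmaK)[t ->] [r /A0P ar <-]]|[u [z [sE az]]]].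
  by exists (rev t), (dual_coord r); rewrite dual_coord_dual_map.
pose r : Vdual C := (\pi_(Vdual C) (Ct *m z))%qT.
have rE : dual_coord r = z by exact: dual_coord_pi.
exists (wmap (sigma c d Ct) (rev u)); first by apply/(generated_groupP sigmaK); eexists.
exists r; first by apply/A0P; rewrite rE.
by apply: dual_coord_inj; rewrite dual_coord_dual_map revK rE.
Qed.

Hypothesis oc : forall i, is_ocircle (c i).

(** The group acts linearly on circle vectors and [curv] is linear, so the weighted sum of
    curvatures is the curvature of the image of the weighted sum of circles. *)
Lemma pairing_descartes_tuple t (s : Vdual C) :
  pairing (descartes_tuple c (gact d t)) s = curv (act d t (dual_coord s)).
Proof.
have -> : dual_coord s = \sum_i repr s i 0 *: c i.
  apply/colP => k; rewrite mxE summxE; apply: eq_bigr => i _.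
  by rewrite !mxE mulrC.
rewrite /pairing /dotv mxE.
elim/big_rec2: _ => [|i x y _ ->]; first by rewrite act0 // /curv mxE.
by rewrite actD actZ !coordE !mxE /packing_tuple circle_image_gact // mulrC.
Qed.

End Roots.

(** * Consequences of the polyhedral configuration and of boundedness *)

Section Configuration.
Variables (R : realType) (m n : nat) (v : 'I_m -> 'rV[R]_3) (F : 'I_n -> {set 'I_m}).
Variables (c : 'I_m -> 'cV[R]_4) (d : 'I_n -> 'cV[R]_4).
Hypothesis poly : convex_polyhedron v F.
Hypothesis conf : polyhedral_configuration v F c d.
Hypothesis bounded : bounded_packing c d.

Lemma facet_vertex j : exists i, i \in F j.
Proof.
have [_ rk] : is_facet v (F j) by apply/(polyhedron_faceP poly); exists j.
apply/set0Pn; apply/eqP => F0; move: rk.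
by rewrite /aff_rank F0 big_set0 mxrank0.
Qed.

Lemma dual_circles_ip j l : j != l -> ip (d j) (d l) <= -1 /\ future (d j + d l).
Proof.
move=> /eqP jl; apply: disjoint_interiors_ip; try exact: config_dual_circle conf _.
exact: config_dual_interiors conf _ _ jl.
Qed.

Lemma dual_circles_neqN j l : j != l -> d j + d l <> 0.
Proof.
move=> /eqP jl; have oj := config_dual_circle conf j.
have [e|e] := pselect (share_edge v F j l).
  exact: tangent_neqN oj (config_dual_tangent conf e).
exact: disjoint_neqN oj (config_dual_disjoint conf jl e).
Qed.

Lemma incident_ip i j : i \in F j -> ip (c i) (d j) = 0.
Proof.
by move=> ij; apply: orthogonal_circles_ip (config_orthogonal conf ij);
  [exact: config_circle conf _|exact: config_dual_circle conf _].
Qed.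

Lemma packing_bound : exists2 M : R, 0 <= M & forall t i p,
  circle (act d t (c i)) p -> exists2 z : R[i], p = Some z & `|z| <= M%:C.
Proof.
have [M H] := bounded; exists `|M| => // t i p pc.
have od := config_dual_circle conf; have oc := config_circle conf.
have Wt : Wgeom d (gact d t).
  by apply/(generated_groupP (inversionK_dual od)); exists t.
have [|z -> zM] := H _ i p Wt; first by rewrite /packing_tuple circle_image_gact.
by exists z => //; apply: le_trans zM _; rewrite lecR ler_norm.
Qed.

(** Every face has a vertex, whose circle crosses the dual circle; the common point is carried to a
    point of a circle of the bounded packing. *)
Lemma dual_circles_meet : exists2 M : R, 0 <= M & forall t j,
  exists2 z : R[i], circle (act d t (d j)) (Some z) & `|z| <= M%:C.
Proof.
have od := config_dual_circle conf; have oc := config_circle conf.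
have [M M0 H] := packing_bound; exists M => // t j.
have [i ij] := facet_vertex j.
have [[z [zc zd]] _] := config_orthogonal conf ij.
have [|w wE wM] := H t i (gact d t (Some z)); first by rewrite circle_gact.
by exists w; rewrite // -wE circle_gact.
Qed.

(** A circle of curvature 0 passes through infinity, against boundedness. *)
Lemma packing_curv_neq0 t i : curv (act d t (c i)) <> 0.
Proof.
have [M _ H] := packing_bound => c0.
suff /H[] : circle (act d t (c i)) None by [].
apply/in_circle; last by rewrite ip_nul_None c0 oppr0 mul0r.
by apply: ocircle_act; [exact: config_dual_circle conf|exact: config_circle conf _].
Qed.

(** Pairing -1 excludes disjoint circles, so the two faces share an edge; the circle of an end of
    that edge is orthogonal to both. *)
Lemma tangent_dual_circles_vertex s j l : j != l -> ip (d j) (d l) = -1 ->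
  exists x, [/\ ip x (d j) = 0, ip x (d l) = 0 & curv (act d s x) <> 0].
Proof.
move=> /eqP jl jlN; have [[_ [i [_ [_ ij _ il _]]]]|e] := pselect (share_edge v F j l).
  by exists (c i); split; [exact: incident_ip|exact: incident_ip|exact: packing_curv_neq0].
case: (disjoint_circles_ip _ _ (config_dual_disjoint conf jl e) jlN);
  exact: config_dual_circle conf _.
Qed.

End Configuration.

Theorem theorem3p5 (R : realType) (m n : nat)
    (v : 'I_m -> 'rV[R]_3) (F : 'I_n -> {set 'I_m})
    (c : 'I_m -> 'cV[R]_4) (d : 'I_n -> 'cV[R]_4) (Ct : 'M[R]_(m, 4)) :
  convex_polyhedron v F ->
  polyhedral_configuration v F c d ->
  bounded_packing c d ->
  circle_mx c *m Ct = 1%:M ->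
  [set s : Vdual (circle_mx c) | Z_converges c d s] =
  \bigcup_(w in Wgroup c d Ct) (dual_map w @` A0 c d).
Proof.
move=> poly conf bounded CCt.
have od := config_dual_circle conf; have oc := config_circle conf.
have dd := dual_circles_ip conf; have dN := dual_circles_neqN conf.
have [M M0 meet] := dual_circles_meet poly conf bounded.
have [s0 chamber] := exists_chamber od dd dN M0 meet.
have one_wall := chamber_one_wall od dd dN (tangent_dual_circles_vertex conf bounded s0).
have DP := generated_groupP (inversionK_dual od).
apply/seteqP; split=> s; rewrite bigcup_dual_map //= /Z_converges.
  apply: (A0_of_converges od dd chamber one_wall DP).
  by move=> t; rewrite pairing_descartes_tuple.
move=> [u [z [sE az]]]; apply: (converges_of_A0 od dd chamber one_wall DP _ sE az).
by move=> t; rewrite pairing_descartes_tuple.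
Qed.
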